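(* Assume that $a,b$ are $C_{\mathrm{Lip}}$-Lipschitz in $x$ uniformly in time ($|a(s,x)-a(s,y)|\le C_{\mathrm{Lip}}|x-y|$, $\|b(s,x)-b(s,y)\|_{\mathrm F}\le C_{\mathrm{Lip}}|x-y|$), satisfy $|a(s,x)|^2+\|b(s,x)\|_{\mathrm F}^2\le C_{\mathrm{lgb}}(1+|x|^2)$, that $X_0^{\mathrm{true}}$ is $\mathcal F_0$-measurable and square integrable, and that there exist $\alpha>0$, $C_{\mathrm{na}}>0$ with $$|a(t,x)-a(s,x)|+|b(t,x)-b(s,x)|\le C_{\mathrm{na}}(1+|x|)|t-s|^\alpha\quad\text{for all } t,s\in[0,T],\ x\in\mathbb R^d.$$ Consider the uniform partition $t_n=n\Delta t$, $n=0,\dots,N$, of $[0,T]$ with $\Delta t=T/N$. Let $X_n^{\mathrm{EM}}$ be the standard Euler--Maruyama approximation of the SDE, $X^{\mathrm{EM}}_{n+1}=X^{\mathrm{EM}}_n+a(t_n,X_n^{\mathrm{EM}})\Delta t+b(t_n,X_n^{\mathrm{EM}})\Delta W_n$, $X_0^{\mathrm{EM}}=X_0^{\mathrm{true}}$, and let $X_n=U_n^\top Y_n$ be the solution of the DLR Projector Splitting scheme for SDEs with $X_0=U_0^\top Y_0$. Let $X(t)=U(t)^\top Y(t)$ be the rank-$k$ DO solution on $[0,T]$ with initial data $(U_0,Y_0)$, and suppose there is $\gamma>0$ such that $|C_{Y(s)}^{-1}|\le\frac1\gamma$ for all $s\in[0,T]$ and $|C_{Y_n}^{-1}|\le\frac1\gamma$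 for all $n=0,\dots,N-1$. Let $\varepsilon\ge0$ be defined by $$\varepsilon^2:=\sup_{\substack{t\in[0,T],\ Z\in L^2(\Omega;\mathbb R^d)\text{ of rank }k\\ \mathbb E[|Z|^2]\le\tilde K}}\max\big\{\mathbb E[|a(t,Z)-P_Z a(t,Z)|^2],\ \mathbb E[\|b(t,Z)-\mathcal P_{\mathcal U(Z)}b(t,Z)\|_{\mathrm F}^2]\big\},$$ where $\tilde K$ is the smallest $K>0$ with $\max\{\mathbb E[\sup_{0\le t\le T}|X(t)|^2],\ \mathbb E[\max_{0\le n\le N}|X_n|^2]\}\le K$. Then there exists a positive constant $C$, independent of $\gamma$ (and of $\Delta t$), such that $$\sqrt{\mathbb E\Big[\max_{0\le n\le N}|X_n^{\mathrm{EM}}-X_n|^2\Big]}\le C\left(\sqrt{\mathbb E[|X_0^{\mathrm{true}}-X_0|^2]}+(\Delta t)^{\frac12}+\varepsilon\right).$$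
   Context: Setting. $(\Omega,\mathcal F,\mathbb P,(\mathcal F_t)_{t\ge 0})$ is a filtered complete probability space with the usual conditions, $W$ an $m$-dimensional $(\mathcal F_t)$-Brownian motion, $T>0$, $1\le k\le d$, $\Delta W_n=W(t_{n+1})-W(t_n)$. The maps $a:[0,\infty)\times\mathbb R^d\to\mathbb R^d$ and $b:[0,\infty)\times\mathbb R^d\to\mathbb R^{d\times m}$ are Borel measurable; the SDE is $\mathrm dX^{\mathrm{true}}=a(t,X^{\mathrm{true}})\mathrm dt+b(t,X^{\mathrm{true}})\mathrm dW_t$, $X^{\mathrm{true}}(0)=X^{\mathrm{true}}_0$. Notation. $|v|$ Euclidean norm of a vector, $|A|$ spectral norm and $\|A\|_{\mathrm F}$ Frobenius norm of a matrix. For $Y\in L^2(\Omega;\mathbb R^k)$, $C_Y:=\mathbb E[YY^\top]$. For $U\in\mathbb R^{k\times d}$ with orthonormal rows, $P_U:=U^\top U$. A random vector $Z\in L^2(\Omega;\mathbb R^d)$ has rank $k$ if $\mathbb E[ZZ^\top]$ has rank $k$, equivalently $Z=U^\top Y$ with $U\in\mathbb R^{k\times d}$ having orthonormal rows and $Y\in L^2(\Omega;\mathbb R^k)$ having linearly independent components. For such $Z$, $\mathcal P_{\mathcal U(Z)}:=U^\top U$, $\mathcal P_{\mathcal Y(Z)}[V]:=\mathbb E[VY^\top]C_Y^{-1}Y$ for $V\in L^2(\Omega;\mathbb R^d)$, and $P_Z[V]:=(I_{d\times d}-\mathcal P_{\mathcal U(Z)})\mathcal P_{\mathcal Y(Z)}[V]+\mathcal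 P_{\mathcal U(Z)}V$. Initial data. $U_0\in\mathbb R^{k\times d}$ with $U_0U_0^\top=I_{k\times k}$, and $Y_0\in L^2(\Omega;\mathbb R^k)$ is $\mathcal F_0$-measurable with linearly independent components (so $C_{Y_0}$ is invertible). DO solution. $X(t)=U(t)^\top Y(t)$ where $U:[0,T]\to\mathbb R^{k\times d}$ is deterministic, absolutely continuous, with $U(t)U(t)^\top=I_{k\times k}$, $U(t)\dot U(t)^\top=0$, $U(0)=U_0$, and $Y$ is an adapted process with a.s. continuous paths in $\mathbb R^k$, square integrable, with components linearly independent in $L^2(\Omega)$ at each time, such that $$C_{Y(t)}\dot U(t)=\mathbb E[Y(t)a(t,U(t)^\top Y(t))^\top](I_{d\times d}-P_{U(t)}),$$ $$Y(t)=Y_0+\int_0^tU(s)a(s,U(s)^\top Y(s))\mathrm ds+\int_0^tU(s)b(s,U(s)^\top Y(s))\mathrm dW_s.$$ It is assumed to exist on $[0,T]$. DLR Projector Splitting scheme for SDEs. For $n=0,\dots,N-1$ set $$\tilde Y_{n+1}=Y_n+U_na(t_n,U_n^\top Y_n)\Delta t+U_nb(t_n,U_n^\top Y_n)\Delta W_n,$$ let $\tilde U_{n+1}$ solve $$C_{\tilde Y_{n+1}}\tilde U_{n+1}=C_{\tilde Y_{n+1}}U_n+\mathbb E[\tilde Y_{n+1}a(t_n,U_n^\top Y_n)^\top](I_{d\times d}-P_{U_n})\Delta t$$ (minimal norm solution if $C_{\tilde Y_{n+1}}$ is singular), compute a reduced QR decomposition $\tilde U_{n+1}^\top=U_{n+1}^\top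 R_{n+1}$ with $U_{n+1}U_{n+1}^\top=I_{k\times k}$, $R_{n+1}\in\mathbb R^{k\times k}$, and set $Y_{n+1}=R_{n+1}\tilde Y_{n+1}$; $X_n=U_n^\top Y_n$. *)

(* Defs.v *)
From HB Require Import structures.
From mathcomp Require Import all_boot all_order all_algebra.
From mathcomp Require Import all_classical all_reals all_analysis.

Set Implicit Arguments.
Unset Strict Implicit.
Unset Printing Implicit Defensive.

Import Order.TTheory GRing.Theory Num.Theory.
Import numFieldNormedType.Exports.

Local Open Scope classical_set_scope.
Local Open Scope ring_scope.

Section Norms.
Context {R : realType}.

(* The library norm on matrices is the max norm, hence the norms below. *)
Definition enorm n (v : 'cV[R]_n) : R := Num.sqrt (\sum_i v i 0 ^+ 2).

Definition frob p q (A : 'M[R]_(p, q)) : R :=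
  Num.sqrt (\sum_i \sum_j A i j ^+ 2).

Definition specnorm p q (A : 'M[R]_(p, q)) : R :=
  sup [set enorm (A *m v) | v in [set v : 'cV[R]_q | enorm v <= 1]].

Definition min_norm_solution p q (A : 'M[R]_p) (B X : 'M[R]_(p, q)) : Prop :=
  A *m X = B /\ forall X', A *m X' = B -> frob X <= frob X'.

Definition abs_continuous (T : R) (f : R -> R) : Prop :=
  forall e, 0 < e -> exists2 delta, 0 < delta &
  forall n (x y : nat -> R),
    (forall i, (i < n)%N -> 0 <= x i /\ x i <= y i /\ y i <= T) ->
    (forall i j, (i < j < n)%N -> y i <= x j) ->
    \sum_(i < n) (y i - x i) < delta ->
    \sum_(i < n) `|f (y i) - f (x i)| < e.

(* The Borel sigma-algebra of [R * R^d] is the library product sigma-algebra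
   on [R * d.-tuple R]; the library has none on matrices. *)
Definition borel_coefficient d p q (f : R -> 'cV[R]_d -> 'M[R]_(p, q)) : Prop :=
  forall i j, measurable_fun
    [set z : measurableTypeR R * d.-tuple (measurableTypeR R) | 0 <= z.1]
    (fun z => f z.1 (\col_l tnth z.2 l) i j : measurableTypeR R).

End Norms.

Section RandomVectors.
Context {R : realType} {disp : measure_display} {Omega : measurableType disp}.
Variable P : probability Omega R.

Definition mx_measurable (G : set (set Omega)) p q (X : Omega -> 'M[R]_(p, q)) :
    Prop :=
  forall i j, preimage_set_system setT
    (fun w => X w i j : measurableTypeR R) measurable `<=` G.

Definition L2 n (X : Omega -> 'cV[R]_n) : Prop :=
  forall i, (fun w => X w i 0) \in Lfun P 2%:E.

Definition emx p q (M : Omega -> 'M[R]_(p, q)) : 'M[R]_(p, q) :=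
  \matrix_(i, j) fine ('E_P[fun w => M w i j])%E.

Definition gram n (Y : Omega -> 'cV[R]_n) : 'M[R]_n :=
  emx (fun w => Y w *m (Y w)^T).

Definition lin_indep n (Y : Omega -> 'cV[R]_n) : Prop :=
  forall c : 'rV[R]_n, {ae P, forall w, c *m Y w = 0} -> c = 0.

Definition projU k d (U : 'M[R]_(k, d)) : 'M[R]_d := U^T *m U.

Definition projY k d (Y : Omega -> 'cV[R]_k) (V : Omega -> 'cV[R]_d) :
    Omega -> 'cV[R]_d :=
  fun w => emx (fun w' => V w' *m (Y w')^T) *m invmx (gram Y) *m Y w.

(* [tangent_proj U Y] is $P_Z$ for $Z = U^\top Y$; it does not depend on the
   choice of the factors. *)
Definition tangent_proj k d (U : 'M[R]_(k, d)) (Y : Omega -> 'cV[R]_k)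
    (V : Omega -> 'cV[R]_d) : Omega -> 'cV[R]_d :=
  fun w => (1%:M - projU U) *m projY Y V w + projU U *m V w.

Definition has_rank k d (Z : Omega -> 'cV[R]_d) : Prop :=
  L2 Z /\ \rank (gram Z) = k.

Definition low_rank_factors k d (Z : Omega -> 'cV[R]_d)
    (U : 'M[R]_(k, d)) (Y : Omega -> 'cV[R]_k) : Prop :=
  [/\ U *m U^T = 1%:M, L2 Y, lin_indep Y & {ae P, forall w, Z w = U^T *m Y w}].

Definition eps2 k d m (a : R -> 'cV[R]_d -> 'cV[R]_d)
    (b : R -> 'cV[R]_d -> 'M[R]_(d, m)) (T : R) (K : \bar R) : \bar R :=
  ereal_sup [set v | exists t Z (U : 'M[R]_(k, d)) Y,
    [/\ 0 <= t <= T, has_rank k Z, low_rank_factors Z U Y,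
        ('E_P[fun w => (enorm (Z w) ^+ 2)%R] <= K)%E &
        v = (maxe
          'E_P[fun w => (enorm (a t (Z w) -
                 tangent_proj U Y (fun w' => a t (Z w')) w) ^+ 2)%R]
          'E_P[fun w => (frob (b t (Z w) - projU U *m b t (Z w)) ^+ 2)%R])%E]].

(* The smallest [K > 0] bounding both second moments, [+oo] if there is none. *)
Definition Ktilde d (T : R) (X : R -> Omega -> 'cV[R]_d)
    (N : nat) (Xn : nat -> Omega -> 'cV[R]_d) : \bar R :=
  ereal_inf [set K%:E | K in [set K : R | 0 < K /\
    (maxe (\int[P]_w ereal_sup [set (enorm (X t w) ^+ 2)%:E | t in `[0%R, T]])
          'E_P[fun w => (\big[Num.max/0]_(n < N.+1) enorm (Xn n w) ^+ 2)%R]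
     <= K%:E)%E]].

(* Convergence to 0 in probability; stated with a measurable superset so that
   it is meaningful without a measurability assumption on [Z n]. *)
Definition cvg0_in_probability (Z : nat -> Omega -> \bar R) : Prop :=
  forall e delta : R, 0 < e -> 0 < delta -> \forall n \near \oo,
  exists A, [/\ measurable A, [set w | (e%:E < Z n w)%E] `<=` A &
                (P A <= delta%:E)%E].

End RandomVectors.

Section StochasticCalculus.
Context {R : realType} {disp : measure_display} {Omega : measurableType disp}.
Variable P : probability Omega R.

Record usual_conditions (F : R -> set (set Omega)) : Prop := {
  uc_complete : measure_is_complete P;
  uc_sigma_algebra : forall t, 0 <= t -> sigma_algebra setT (F t);
  uc_measurable : forall t, 0 <= t -> F t `<=` measurable;
  uc_increasing : forall s t, 0 <= s -> s <= t -> F s `<=` F t;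
  uc_right_continuous : forall t, 0 <= t ->
    \bigcap_(s in [set s | t < s]) F s `<=` F t;
  uc_null_sets : P.-negligible `<=` F 0 }.

Variable F : R -> set (set Omega).

(* The second argument of [normal_prob] is the standard deviation. *)
Record brownian_motion m (W : R -> Omega -> 'cV[R]_m) : Prop := {
  bm_adapted : forall t, 0 <= t -> mx_measurable (F t) (W t);
  bm_start : {ae P, forall w, W 0 w = 0};
  bm_paths : {ae P, forall w, forall i,
    {within `[0, +oo[, continuous (fun t => W t w i 0)}};
  bm_independent : forall s t, 0 <= s -> s < t ->
    forall A B, F s A ->
    <<s \bigcup_i preimage_set_system setT
          (fun w => (W t w - W s w) i 0 : measurableTypeR R) measurable >> B ->
    P (A `&` B) = (P A * P B)%E;
  bm_gaussian : forall s t, 0 <= s -> s < t ->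
    forall B : 'I_m -> set (measurableTypeR R), (forall i, measurable (B i)) ->
    P [set w | forall i, B i ((W t w - W s w) i 0)] =
    (\prod_i normal_prob 0 (Num.sqrt (t - s)) (B i))%E }.

Variables (m : nat) (W : R -> Omega -> 'cV[R]_m).

(* The simple process equal to [sp_val i] on $]$[sp_time i], [sp_time i.+1]$]$
   for [i < sp_size]. *)
Record simple_process k := SimpleProcess {
  sp_size : nat;
  sp_time : nat -> R;
  sp_val : nat -> Omega -> 'M[R]_(k, m) }.

Record simple_adapted k (t : R) (H : simple_process k) : Prop := {
  sa_first : sp_time H 0 = 0;
  sa_last : sp_time H (sp_size H) = t;
  sa_nondecreasing : forall i, (i < sp_size H)%N ->
    sp_time H i <= sp_time H i.+1;
  sa_measurable : forall i, (i < sp_size H)%N ->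
    mx_measurable (F (sp_time H i)) (sp_val H i);
  sa_bounded : forall i, (i < sp_size H)%N ->
    exists M : R, forall w, frob (sp_val H i w) <= M }.

Definition simple_eval k (H : simple_process k) (s : R) (w : Omega) :
    'M[R]_(k, m) :=
  \sum_(i < sp_size H | sp_time H i < s <= sp_time H i.+1) sp_val H i w.

Definition simple_integral k (H : simple_process k) (w : Omega) : 'cV[R]_k :=
  \sum_(i < sp_size H)
     sp_val H i w *m (W (sp_time H i.+1) w - W (sp_time H i) w).

(* [I] is (a version of) the Ito integral $\int_0^t H(s) dW_s$: the limit in
   probability of the integrals of bounded simple adapted processes that
   approximate [H] in $L^2([0,t])$, in probability. *)
Definition is_ito_integral k (t : R) (H : R -> Omega -> 'M[R]_(k, m))
    (I : Omega -> 'cV[R]_k) : Prop :=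
  exists Hn : nat -> simple_process k,
    [/\ forall n, simple_adapted t (Hn n),
        cvg0_in_probability P (fun n w =>
          (\int[lebesgue_measure]_(s in `[0%R, t])
             ((frob (simple_eval (Hn n) s w - H s w)) ^+ 2)%:E)%E) &
        cvg0_in_probability P (fun n w =>
          (enorm (simple_integral (Hn n) w - I w))%:E)].

Variables (d : nat) (a : R -> 'cV[R]_d -> 'cV[R]_d)
  (b : R -> 'cV[R]_d -> 'M[R]_(d, m)).

Definition dtime k (U : R -> 'M[R]_(k, d)) (t : R) : 'M[R]_(k, d) :=
  \matrix_(i, j) derive1 (fun s => U s i j) t.

Record DO_solution k (T : R) (U0 : 'M[R]_(k, d)) (Y0 : Omega -> 'cV[R]_k)
    (U : R -> 'M[R]_(k, d)) (Y : R -> Omega -> 'cV[R]_k) : Prop := {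
  do_U_ac : forall i j, abs_continuous T (fun t => U t i j);
  do_U_orth : forall t, 0 <= t <= T -> U t *m (U t)^T = 1%:M;
  do_U_init : U 0 = U0;
  do_U_derivable : {ae @lebesgue_measure R, forall t, 0 < t < T ->
    forall i j, derivable (fun s => U s i j) t 1};
  do_U_gauge : {ae @lebesgue_measure R, forall t, 0 < t < T ->
    U t *m (dtime U t)^T = 0};
  do_Y_adapted : forall t, 0 <= t <= T -> mx_measurable (F t) (Y t);
  do_Y_paths : {ae P, forall w, forall i,
    {within `[0, T], continuous (fun t => Y t w i 0)}};
  do_Y_L2 : forall t, 0 <= t <= T -> L2 P (Y t);
  do_Y_lin_indep : forall t, 0 <= t <= T -> lin_indep P (Y t);
  do_U_eq : {ae @lebesgue_measure R, forall t, 0 < t < T ->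
    gram P (Y t) *m dtime U t =
    emx P (fun w => Y t w *m (a t ((U t)^T *m Y t w))^T) *m
      (1%:M - projU (U t))};
  do_Y_eq : forall t, 0 <= t <= T -> exists I,
    is_ito_integral t (fun s w => U s *m b s ((U s)^T *m Y s w)) I /\
    {ae P, forall w, Y t w = Y0 w
       + \col_i (\int[lebesgue_measure]_(s in `[0%R, t])
                   (U s *m a s ((U s)^T *m Y s w)) i 0)%R
       + I w} }.

Definition increment (dt : R) (n : nat) (w : Omega) : 'cV[R]_m :=
  W (n.+1%:R * dt) w - W (n%:R * dt) w.

Fixpoint euler_maruyama (dt : R) (X0 : Omega -> 'cV[R]_d) (n : nat)
    (w : Omega) : 'cV[R]_d :=
  if n is n'.+1 then
    let x := euler_maruyama dt X0 n' w in
    x + dt *: a (n'%:R * dt) x + b (n'%:R * dt) x *m increment dt n' w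
  else X0 w.

(* One step from [(U, Y)] at time $t_n$ to [(U', Y')] at time $t_{n+1}$. *)
Definition DLR_PS_step k (dt : R) (n : nat)
    (U : 'M[R]_(k, d)) (Y : Omega -> 'cV[R]_k)
    (U' : 'M[R]_(k, d)) (Y' : Omega -> 'cV[R]_k) : Prop :=
  let tn := n%:R * dt in
  let X w := U^T *m Y w in
  let Yt w := Y w + dt *: (U *m a tn (X w))
                  + U *m b tn (X w) *m increment dt n w in
  exists (Ut : 'M[R]_(k, d)) (Rn : 'M[R]_k),
    [/\ min_norm_solution (gram P Yt)
          (gram P Yt *m U + dt *: (emx P (fun w => Yt w *m (a tn (X w))^T) *m
                                     (1%:M - projU U))) Ut,
        Ut^T = U'^T *m Rn,
        U' *m U'^T = 1%:M,
        is_trig_mx Rn^T &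
        forall w, Y' w = Rn *m Yt w].

Definition DLR_PS_scheme k (dt : R) (N : nat)
    (U0 : 'M[R]_(k, d)) (Y0 : Omega -> 'cV[R]_k)
    (U : nat -> 'M[R]_(k, d)) (Y : nat -> Omega -> 'cV[R]_k) : Prop :=
  [/\ U 0%N = U0, Y 0%N = Y0 &
      forall n, (n < N)%N -> DLR_PS_step dt n (U n) (Y n) (U n.+1) (Y n.+1)].

End StochasticCalculus.

(* Main.v *)
(** The low-rank iterate is compared directly with Euler--Maruyama; the DO
    solution enters only through [Ktilde].  Writing [Yt] for the predictor, the
    normal equation for [Ut] says that
      X_{n+1} = X_n + dt (a - r_n) + P_U b dW,   r_n = (I - P_U)(a - Pi a),
    where [a = a(t_n, X_n)] and [Pi] is the L2 projection onto the span of [Yt].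
    The independence of [gamma] comes from the estimate of [r_n]: for
    [n + 1 < N] the random vector [U_n^T Yt] has rank [k] and second moment at
    most [Ktilde], so [eps] bounds [(I - P_U)(h - Pi h)] for
    [h = a(t_n, U_n^T Yt)], and [a - h = O(|Yt - Y_n|)] is of order [dt ^ (1/2)]
    by the Lipschitz condition, so no inverse Gram matrix is ever estimated.
    At the last step [|r_n| <= |a|] is enough, since it is multiplied by [dt].
    Doob's inequality and a discrete Gronwall argument conclude. *)

Require Import Defs.
From HB Require Import structures.
From mathcomp Require Import all_boot all_order all_algebra.
From mathcomp Require Import all_classical all_reals all_analysis.
From mathcomp Require Import measurable_realfun ring lra.

Set Implicit Arguments.
Unset Strict Implicit.
Unset Printing Implicit Defensive.

Import Order.TTheory GRing.Theory Num.Theory.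
Import numFieldNormedType.Exports.

Local Open Scope classical_set_scope.
Local Open Scope ring_scope.

(** * Gaussian laws and independence *)

Section gaussian.
Context {R : realType}.
Local Notation mu := (@lebesgue_measure R).

(** Since X_n itself is admissible in [eps], one would like to bound (I - P_U)(a - Pi a) directly.
    But Pi projects onto the span of the predictor, not onto that of Y_n, and comparing the two
    projections costs an inverse Gram matrix, that is 1/gamma. The way out is to move the point at
    which the drift is evaluated rather than the space: h = a(t_n, U_n^T Yt) is paired with the span
    that its own argument generates. That this argument is admissible is read off the next iterate:
    Y_{n+1} = R Yt transfers invertibility of the Gram matrix back to Yt, and U_n V^T = 0, where V =
    (Ut - U_n)/dt, makes U_n^T Yt equal to P_U X_{n+1}. The Gram hypothesis stops at Y_{N-1}, which
    is why the last step is separate. A second constraint is the order of quantifiers: C is fixed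
    before U_0, Y_0 and N, so moments of X_n must not enter it. They are bounded by those of
    Euler-Maruyama plus the error itself, which Gronwall absorbs. *)

Lemma ge0_integral_normal_prob (m s : R) (f : measurableTypeR R -> \bar R) :
  measurable_fun setT f -> (forall x, (0 <= f x)%E) ->
  (\int[normal_prob m s]_x f x = \int[mu]_x (f x * (normal_pdf m s x)%:E))%E.
Proof.
move=> mf f0; have dom := @normal_prob_dominates R m s.
rewrite -(@Radon_Nikodym_SigmaFinite.change_of_variables _ _ _ _ mu dom)//.
apply: ae_eq_integral => //.
- apply: emeasurable_funM => //; apply: (measurable_int mu).
  exact: Radon_Nikodym_SigmaFinite.f_integrable.
- apply: emeasurable_funM => //; apply/measurable_EFinP.
  exact: measurable_normal_pdf.
(* The Radon-Nikodym derivative is known only through its integrals over measurable sets, which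
   identify it with the density almost everywhere. *)
- apply: ae_eqe_mul2l => /=.
  apply: integral_ae_eq => //=.
  + exact: Radon_Nikodym_SigmaFinite.f_integrable.
  + by apply/measurable_EFinP; exact: measurable_normal_pdf.
  + move=> E _ mE; rewrite -Radon_Nikodym_SigmaFinite.f_integral//.
Qed.

(** The density is even and Lebesgue measure is invariant under reflection. This symmetry later
    makes the increments centred without computing a first moment. *)
Lemma normal_probN (s : R) (A : set (measurableTypeR R)) :
  s != 0 -> measurable A ->
  normal_prob 0 s (-%R @^-1` A) = normal_prob 0 s A.
Proof.
move=> s0 mA; rewrite /normal_prob.
have mN : measurable_fun setT (-%R : measurableTypeR R -> measurableTypeR R).
  exact: oppr_measurable.
have mpdf : measurable_fun A (fun x => (normal_pdf 0 s x)%:E).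
  by apply/measurable_funTS/measurable_EFinP; exact: measurable_normal_pdf.
transitivity (\int[pushforward mu (-%R : _ -> measurableTypeR R)]_(x in A)
    (normal_pdf 0 s x)%:E)%E.
  rewrite ge0_integral_pushforward//; last first.
    by move=> y _; rewrite lee_fin normal_pdf_ge0.
  apply: eq_integral => x _; congr EFin.
  by rewrite /= !normal_pdfE// /normal_fun !subr0 sqrrN.
apply: eq_measure_integral => B mB _.
  exact: (lebesgue_measureN mB).
Qed.

(* [y <= exp y] at [y = (x / 2 s) ^ 2] bounds [x ^ 2] times the density of
   variance [s ^ 2] by a multiple of the density of variance [2 * s ^ 2]. *)
Lemma normal_prob_sqr_le (s : R) : 0 < s ->
  (\int[normal_prob 0 s]_x (x ^+ 2)%:E <= (4 * Num.sqrt 2 * s ^+ 2)%:E)%E.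
Proof.
move=> s0; pose c := 4 * Num.sqrt 2 * s ^+ 2.
have c0 : 0 <= c by rewrite /c !mulr_ge0 ?sqrtr_ge0 // ltW.
have t0 : 0 < Num.sqrt 2 * s by rewrite mulr_gt0 ?sqrtr_gt0.
have mpdf t : measurable_fun setT (fun x : R => (normal_pdf 0 t x)%:E).
  by apply/measurable_EFinP; exact: measurable_normal_pdf.
have msqr : measurable_fun setT (fun x : measurableTypeR R => (x ^+ 2)%:E).
  by apply/measurable_EFinP; exact: measurable_funX.
rewrite (@ge0_integral_normal_prob 0 s (fun x => (x ^+ 2)%:E))//; last first.
  by move=> x; rewrite lee_fin sqr_ge0.
rewrite -[leRHS]mule1 -(integral_normal_pdf 0 (Num.sqrt 2 * s)).
rewrite -ge0_integralZl//; first last.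
- by move=> x _; rewrite lee_fin normal_pdf_ge0.
- exact: mpdf.
apply: ge0_le_integral => //.
- by move=> x _; rewrite -EFinM lee_fin mulr_ge0 ?sqr_ge0 ?normal_pdf_ge0.
- by apply: emeasurable_funM => //; exact: mpdf.
- by apply: emeasurable_funM => //; exact: mpdf.
move=> x _; rewrite -!EFinM lee_fin !normal_pdfE ?gt_eqF//.
rewrite /normal_peak /normal_fun subr0 exprMn sqr_sqrtr//.
have -> : 2 * s ^+ 2 * pi *+ 2 = 2 * (s ^+ 2 * pi *+ 2).
  by rewrite mulrnAr mulrA.
rewrite [Num.sqrt (2 * _)]sqrtrM// invfM.
set q := (Num.sqrt (s ^+ 2 * pi *+ 2))^-1.
have q0 : 0 <= q by rewrite invr_ge0 sqrtr_ge0.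
have r2 : Num.sqrt 2 != 0 :> R by rewrite gt_eqF ?sqrtr_gt0.
pose y := x ^+ 2 / (4 * s ^+ 2).
have -> : - x ^+ 2 / (s ^+ 2 *+ 2) = - (2 * y).
  by rewrite /y -mulr_natl; field; rewrite gt_eqF.
have -> : - x ^+ 2 / (2 * s ^+ 2 *+ 2) = - y.
  by rewrite /y -mulr_natl; field; rewrite gt_eqF.
have -> : x ^+ 2 = 4 * s ^+ 2 * y by rewrite /y; field; rewrite gt_eqF.
have H : y * expR (- (2 * y)) <= expR (- y).
  have -> : - (2 * y) = - y - y by ring.
  rewrite expRD mulrA -[leRHS]mul1r ler_wpM2r ?expR_ge0//.
  rewrite expRN ler_pdivrMr ?expR_gt0// mul1r.
  by rewrite (le_trans _ (expR_ge1Dx y))// lerDr.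
move: (expR (- y)) (expR (- (2 * y))) H => e e2 H.
have -> : 4 * Num.sqrt 2 * s ^+ 2 * ((Num.sqrt 2)^-1 * q * e) =
          4 * s ^+ 2 * q * e by field.
have -> : 4 * s ^+ 2 * y * (q * e2) = 4 * s ^+ 2 * q * (y * e2) by ring.
by rewrite ler_wpM2l// !mulr_ge0// ?ltW.
Qed.

End gaussian.

(** * Factorisation of integrals under independence *)

Section independence.
Context {R : realType} {disp : measure_display} {Omega : measurableType disp}.
Variable P : probability Omega R.

(** Independence says that the joint law agrees with the product of the marginals on rectangles,
    hence everywhere; Tonelli then factors the integral. *)
Lemma independent_ge0_integralM (X Z : Omega -> measurableTypeR R)
    (f g : measurableTypeR R -> \bar R) :
  measurable_fun setT X -> measurable_fun setT Z ->
  (forall A B : set (measurableTypeR R), measurable A -> measurable B ->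
    P (X @^-1` A `&` Z @^-1` B) = (P (X @^-1` A) * P (Z @^-1` B))%E) ->
  measurable_fun setT f -> (forall x, (0 <= f x)%E) ->
  measurable_fun setT g -> (forall x, (0 <= g x)%E) ->
  (\int[P]_w (f (X w) * g (Z w)) =
   \int[P]_w f (X w) * \int[P]_w g (Z w))%E.
Proof.
move=> mX mZ XZ mf f0 mg g0.
pose X' : {RV P >-> measurableTypeR R} := mfun_Sub (mem_set mX).
pose Z' : {RV P >-> measurableTypeR R} := mfun_Sub (mem_set mZ).
have mXZ : measurable_fun setT (fun w => (X w, Z w) : _ * _).
  exact: measurable_fun_pair.
pose XZ' : {RV P >-> (measurableTypeR R * measurableTypeR R)%type} :=
  mfun_Sub (mem_set mXZ).
pose h (z : measurableTypeR R * measurableTypeR R) := (f z.1 * g z.2)%E.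
have mh : measurable_fun setT h.
  by apply: emeasurable_funM; apply: measurableT_comp.
have h0 z : (0 <= h z)%E by exact: mule_ge0.
transitivity (\int[distribution P XZ']_z h z)%E.
  by rewrite (ge0_integral_distribution XZ').
transitivity (\int[distribution P X' \x distribution P Z']_z h z)%E.
  apply: eq_measure_integral => A mA _.
  apply/esym/product_measure_unique => //.
rewrite fubini_tonelli1//.
under eq_integral => x _.
  rewrite /fubini_F /h /= ge0_integralZl//.
  over.
rewrite ge0_integralZr//; last by apply: integral_ge0.
by rewrite (ge0_integral_distribution X')// (ge0_integral_distribution Z').
Qed.

End independence.

(** * Squared Frobenius norms and pathwise inequalities *)

Section sum_of_squares.
Context {R : realType}.

(** A polynomial in the entries, serving both [enorm] on columns and [frob] on matrices: estimates
    are done on squares, and roots return only in the final theorem. *)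
Definition sqnorm p q (A : 'M[R]_(p, q)) : R := \sum_i \sum_j A i j ^+ 2.

Lemma sqnorm_ge0 p q (A : 'M[R]_(p, q)) : 0 <= sqnorm A.
Proof. by apply: sumr_ge0 => i _; apply: sumr_ge0 => j _; exact: sqr_ge0. Qed.

Lemma frob_sqr p q (A : 'M[R]_(p, q)) : frob A ^+ 2 = sqnorm A.
Proof. by rewrite sqr_sqrtr ?sqnorm_ge0. Qed.

Lemma enorm_sqr n (v : 'cV[R]_n) : enorm v ^+ 2 = sqnorm v.
Proof.
rewrite sqr_sqrtr; last by apply: sumr_ge0 => i _; exact: sqr_ge0.
by apply: eq_bigr => i _; rewrite big_ord1.
Qed.

Lemma sqnormD p q (A B : 'M[R]_(p, q)) :
  sqnorm (A + B) <= 2 * sqnorm A + 2 * sqnorm B.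
Proof.
rewrite !mulr_sumr -big_split; apply: ler_sum => i _.
rewrite !mulr_sumr -big_split; apply: ler_sum => j _ /=.
rewrite !mxE -subr_ge0.
have -> : 2 * A i j ^+ 2 + 2 * B i j ^+ 2 - (A i j + B i j) ^+ 2 =
          (A i j - B i j) ^+ 2 by ring.
exact: sqr_ge0.
Qed.

Lemma sqnormZ p q (c : R) (A : 'M[R]_(p, q)) :
  sqnorm (c *: A) = c ^+ 2 * sqnorm A.
Proof.
rewrite mulr_sumr; apply: eq_bigr => i _; rewrite mulr_sumr.
by apply: eq_bigr => j _; rewrite mxE exprMn.
Qed.

Lemma sqnormN p q (A : 'M[R]_(p, q)) : sqnorm (- A) = sqnorm A.
Proof. by rewrite -scaleN1r sqnormZ sqrrN expr1n mul1r. Qed.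

(** Lagrange's identity: twice the defect is the sum of (x_i - x_j)^2 over all pairs. *)
Lemma sqr_sum_le n (x : 'I_n -> R) :
  (\sum_i x i) ^+ 2 <= n%:R * \sum_i x i ^+ 2.
Proof.
rewrite -subr_ge0 -(pmulr_rge0 _ (ltr0n R 2)).
suff -> : 2 * (n%:R * (\sum_i x i ^+ 2) - (\sum_i x i) ^+ 2) =
    \sum_i \sum_j (x i - x j) ^+ 2.
  by apply: sumr_ge0 => i _; apply: sumr_ge0 => j _; exact: sqr_ge0.
have cst (y : R) : \sum_(i < n) y = n%:R * y.
  by rewrite sumr_const card_ord mulr_natl.
under [RHS]eq_bigr => i _.
  under eq_bigr => j _.
    have -> : (x i - x j) ^+ 2 = x i ^+ 2 + x j ^+ 2 + (- 2) * x i * x j by ring.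
    over.
  rewrite !big_split /= cst -mulr_sumr; over.
by rewrite !big_split /= cst -!mulr_sumr -mulr_suml -mulr_sumr; ring.
Qed.

Lemma sqnorm_sum p q n (A : 'I_n -> 'M[R]_(p, q)) :
  sqnorm (\sum_l A l) <= n%:R * \sum_l sqnorm (A l).
Proof.
rewrite [X in _ * X]exchange_big mulr_sumr; apply: ler_sum => i _.
rewrite [X in _ * X]exchange_big mulr_sumr; apply: ler_sum => j _ /=.
by rewrite summxE sqr_sum_le.
Qed.

Lemma sqnorm_trace p q (A : 'M[R]_(p, q)) : sqnorm A = \tr (A^T *m A).
Proof.
rewrite /sqnorm exchange_big; apply: eq_bigr => j _.
by rewrite mxE; apply: eq_bigr => i _; rewrite !mxE expr2.
Qed.

Section orthonormal_rows.
Variables (k d : nat) (U : 'M[R]_(k, d)).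
Hypothesis U_orth : U *m U^T = 1%:M.

Lemma projU_tr : (projU U)^T = projU U.
Proof. by rewrite /projU trmx_mul trmxK. Qed.

Lemma projU_idem : projU U *m projU U = projU U.
Proof. by rewrite /projU mulmxA -(mulmxA U^T) U_orth mulmx1. Qed.

Lemma sqnorm_trU q (y : 'M[R]_(k, q)) : sqnorm (U^T *m y) = sqnorm y.
Proof.
by rewrite !sqnorm_trace trmx_mul trmxK mulmxA -(mulmxA y^T) U_orth mulmx1.
Qed.

(** Pythagoras: both factors are symmetric idempotents, so each squared norm is a trace linear in
    the projector, and the projectors add up to the identity. *)
Lemma sqnorm_projU q (A : 'M[R]_(d, q)) :
  sqnorm A = sqnorm (projU U *m A) + sqnorm ((1%:M - projU U) *m A).
Proof.
have idem (Q : 'M[R]_d) : Q^T = Q -> Q *m Q = Q ->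
    (Q *m A)^T *m (Q *m A) = A^T *m (Q *m A).
  by move=> Qt QQ; rewrite trmx_mul Qt -mulmxA (mulmxA Q) QQ.
have PC_tr : (1%:M - projU U)^T = 1%:M - projU U.
  by rewrite linearB /= trmx1 projU_tr.
have PC_idem : (1%:M - projU U) *m (1%:M - projU U) = 1%:M - projU U.
  by rewrite mulmxBl mul1mx mulmxBr mulmx1 projU_idem subrr subr0.
rewrite !sqnorm_trace (idem _ projU_tr projU_idem) (idem _ PC_tr PC_idem).
by rewrite -raddfD -mulmxDr -mulmxDl addrC subrK mul1mx.
Qed.

Lemma sqnorm_projU_le q (A : 'M[R]_(d, q)) :
  sqnorm (projU U *m A) <= sqnorm A.
Proof. by rewrite [leRHS]sqnorm_projU lerDl sqnorm_ge0. Qed.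

Lemma sqnorm_projUC_le q (A : 'M[R]_(d, q)) :
  sqnorm ((1%:M - projU U) *m A) <= sqnorm A.
Proof. by rewrite [leRHS]sqnorm_projU lerDr sqnorm_ge0. Qed.

Lemma sqnorm_U_le q (A : 'M[R]_(d, q)) : sqnorm (U *m A) <= sqnorm A.
Proof. by rewrite -sqnorm_trU mulmxA sqnorm_projU_le. Qed.

End orthonormal_rows.
End sum_of_squares.

(** * Running maxima, the pathwise Doob inequality and Gronwall *)

Section pathwise.
Context {R : realType}.

(** The index [n] is included. The default 0 makes this the true maximum for nonnegative sequences,
    the only ones it is used for, and matches the maximum in the theorem. *)
Definition runmax (x : nat -> R) n : R := \big[Num.max/0]_(i < n.+1) x i.

Lemma runmax0 (x : nat -> R) : 0 <= x 0%N -> runmax x 0 = x 0%N.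
Proof. by move=> x0; rewrite /runmax big_ord_recl big_ord0; exact/max_idPl. Qed.

Lemma runmax_ge0 (x : nat -> R) n : 0 <= runmax x n.
Proof. exact: bigmax_ge_id. Qed.

Lemma le_runmax (x : nat -> R) n i : (i <= n)%N -> x i <= runmax x n.
Proof.
move=> lin; rewrite -[i]/(nat_of_ord (Ordinal (lin : (i < n.+1)%N))).
exact: le_bigmax.
Qed.

Lemma runmax_le (x : nat -> R) n c :
  0 <= c -> (forall i, (i <= n)%N -> x i <= c) -> runmax x n <= c.
Proof. by move=> c0 xc; apply: bigmax_le => // i _; exact: xc (ltn_ord i). Qed.

Lemma runmaxS (x : nat -> R) n :
  runmax x n.+1 = Num.max (runmax x n) (x n.+1).
Proof.
apply/eqP; rewrite eq_le ge_max le_runmax// andbT; apply/andP; split.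
  apply: runmax_le => [|i]; first by rewrite le_max runmax_ge0.
  rewrite leq_eqVlt => /predU1P[->|]; first by rewrite le_max lexx orbT.
  by rewrite ltnS => lin; rewrite le_max le_runmax.
apply: runmax_le => [|i lin]; first exact: runmax_ge0.
by rewrite le_runmax// ltnW.
Qed.

(** A sign with value 1 at 0, so that its modulus is always 1; the indicator form makes its
    measurability immediate. *)
Definition sg1 (x : R) : R := 2 * \1_[set y | 0 <= y] x - 1.

Lemma sg1E x : sg1 x = if 0 <= x then 1 else -1.
Proof.
rewrite /sg1 indicE; case: ifPn => x0.
  by rewrite mem_set//= mulr1; ring.
by rewrite memNset ?mulr0 ?sub0r//=; exact/negP.
Qed.

Lemma sg1_id x : sg1 x * x = `|x|.
Proof.
rewrite sg1E; case: ifPn => x0; first by rewrite mul1r ger0_norm.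
by rewrite mulN1r ltr0_norm // ltNge.
Qed.

Lemma normr_sg1 x : `|sg1 x| = 1.
Proof. by rewrite sg1E; case: ifP; rewrite ?normrN normr1. Qed.

Lemma sg1_le x y : sg1 x * y <= `|y|.
Proof. by rewrite (le_trans (ler_norm _))// normrM normr_sg1 mul1r. Qed.

(* The integrand of the martingale transform is [- 4] times the running maximum
   with the sign of the path; the induction keeps the sharper bound
   [4 q |x| - 2 q ^ 2], which a new maximum [q = |x|] cannot decrease. *)
Lemma doob_pathwise (x : nat -> R) n :
  runmax (fun i => `|x i|) n ^+ 2 <= 4 * x n ^+ 2
    - 4 * \sum_(i < n) runmax (fun i => `|x i|) i * sg1 (x i) * (x i.+1 - x i).
Proof.
set q := runmax _.
suff H : 4 * \sum_(i < n) q i * sg1 (x i) * (x i.+1 - x i)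
          <= 4 * q n * `|x n| - 2 * q n ^+ 2.
  rewrite -[x n ^+ 2]real_normK ?num_real//.
  move: H; move: (\sum_(i < n) _) (q n) `|x n| => s p y H.
  (* Completing the square is where Doob's constant 4 comes from: the gap is (p - 2 y)^2. *)
  by have := sqr_ge0 (p - 2 * y); nra.
elim: n => [|n IH].
  rewrite big_ord0 mulr0 {}/q runmax0//.
  by have := sqr_ge0 (`|x 0%N|); nra.
rewrite big_ord_recr /= mulrDr.
have q0 := runmax_ge0 (fun i => `|x i|) n; rewrite -/(q n) in q0.
have h : q n * sg1 (x n) * (x n.+1 - x n) <= q n * (`|x n.+1| - `|x n|).
  by rewrite -mulrA ler_wpM2l// mulrBr sg1_id lerB// sg1_le.
have hq : 4 * q n * `|x n.+1| - 2 * q n ^+ 2 <=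
          4 * q n.+1 * `|x n.+1| - 2 * q n.+1 ^+ 2.
  rewrite (_ : q n.+1 = Num.max (q n) `|x n.+1|); last exact: runmaxS.
  case: (leP (q n) `|x n.+1|) => [qx|//].
  by have := sqr_ge0 (q n - `|x n.+1|); nra.
apply: (le_trans _ hq); move: IH h; set s := \sum_(i < n) _.
move: (q n * sg1 _ * _) => r IH h; nra.
Qed.

Lemma runmax_sqr (x : nat -> R) n :
  runmax (fun i => x i ^+ 2) n <= runmax (fun i => `|x i|) n ^+ 2.
Proof.
apply: runmax_le => [|i lin]; first exact: sqr_ge0.
rewrite -[x i ^+ 2]real_normK ?num_real// lerXn2r ?nnegrE ?runmax_ge0//.
exact: (le_runmax (fun i => `|x i|)).
Qed.

(** The induction runs on the majorant [G + A * \sum v], which grows by a factor of at most [1 + A]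
    per step; then 1 + A <= exp A. *)
Lemma discrete_gronwall (v : nat -> R) (G A : R) N : 0 <= A -> 0 <= G ->
  (forall n, (n <= N)%N -> v n <= G + A * \sum_(i < n) v i) ->
  forall n, (n <= N)%N -> v n <= G * expR (A * n%:R).
Proof.
move=> A0 G0 H.
have key n : (n <= N)%N -> G + A * \sum_(i < n) v i <= G * (1 + A) ^+ n.
  elim: n => [|n IH] nN; first by rewrite big_ord0 mulr0 addr0 expr0 mulr1.
  rewrite big_ord_recr /= exprSr mulrA.
  have IH' := IH (ltnW nN).
  have Hn := H n (ltnW nN).
  set s := \sum_(i < n) _ in IH' Hn *; set p := _ ^+ n in IH' *.
  rewrite (_ : G + A * (s + v n) = (G + A * s) + A * v n); last by ring.
  rewrite mulrDr mulr1 lerD// [leRHS]mulrC ler_wpM2l//.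
  exact: le_trans Hn IH'.
move=> n nN; rewrite (le_trans (H n nN))// (le_trans (key n nN))//.
rewrite ler_wpM2l// [A * _]mulrC expRM_natl lerXn2r ?nnegrE ?expR_ge0//.
  by rewrite addr_ge0.
exact: expR_ge1Dx.
Qed.

End pathwise.

(** * Moments and adapted variables *)

Section moments.
Context {R : realType} {disp : measure_display} {Omega : measurableType disp}.
Variable P : probability Omega R.
Implicit Types f g : Omega -> R.

Definition integ f := P.-integrable setT (EFin \o f).
(** Real valued, with the junk value of [fine] when the integral is infinite; hence the
    integrability side conditions throughout. *)
Definition mean f : R := Rintegral P setT f.

Lemma integ_measurable f : integ f -> measurable_fun setT f.
Proof. by move=> /integrableP[/measurable_EFinP]. Qed.

Lemma integ_dom f g : measurable_fun setT f -> (forall w, `|f w| <= g w) ->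
  integ g -> integ f.
Proof.
move=> mf fg; apply: le_integrable => //; first exact/measurable_EFinP.
by move=> w _ /=; rewrite lee_fin (le_trans (fg w))// ler_norm.
Qed.

Lemma integ_cst c : integ (fun=> c).
Proof. exact: finite_measure_integrable_cst. Qed.

Lemma integD f g : integ f -> integ g -> integ (fun w => f w + g w).
Proof. by move=> If Ig; exact: integrableD If Ig. Qed.

Lemma integZ c f : integ f -> integ (fun w => c * f w).
Proof. by move=> If; exact: (@integrableZl _ _ _ _ _ measurableT c _ If). Qed.

Lemma integ_norm f : integ f -> integ (fun w => `|f w|).
Proof.
move=> If; apply: (le_integrable measurableT _ _ If).
  by apply/measurable_EFinP/measurableT_comp => //; exact: integ_measurable.
by move=> w _ /=; rewrite normr_id.
Qed.

Lemma integ_sum I (s : seq I) (f : I -> Omega -> R) :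
  (forall i, integ (f i)) -> integ (fun w => \sum_(i <- s) f i w).
Proof.
move=> If; elim: s => [|i s IH].
  by under [X in integ X]eq_fun do rewrite big_nil; exact: integ_cst.
by under [X in integ X]eq_fun do rewrite big_cons; exact: integD.
Qed.

Lemma meanD f g : integ f -> integ g ->
  mean (fun w => f w + g w) = mean f + mean g.
Proof. by move=> If Ig; exact: RintegralD. Qed.

Lemma meanZ c f : integ f -> mean (fun w => c * f w) = c * mean f.
Proof. by move=> If; exact: RintegralZl. Qed.

Lemma mean_cst c : mean (fun=> c) = c.
Proof.
by have := @expectation_cst _ _ _ P c; rewrite unlock /mean /Rintegral => ->.
Qed.

Lemma mean_sum I (s : seq I) (f : I -> Omega -> R) :
  (forall i, integ (f i)) ->
  mean (fun w => \sum_(i <- s) f i w) = \sum_(i <- s) mean (f i).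
Proof.
move=> If; elim: s => [|i s IH].
  by under [X in mean X]eq_fun do rewrite big_nil; rewrite big_nil mean_cst.
under [X in mean X]eq_fun do rewrite big_cons.
by rewrite big_cons meanD ?IH//; exact: integ_sum.
Qed.

Lemma le_mean f g : integ f -> integ g -> (forall w, f w <= g w) ->
  mean f <= mean g.
Proof. by move=> If Ig fg; exact: le_Rintegral. Qed.

Lemma mean_ge0 f : (forall w, 0 <= f w) -> 0 <= mean f.
Proof. by move=> f0; exact: Rintegral_ge0. Qed.

Lemma expectationE f : integ f -> 'E_P[f]%E = (mean f)%:E.
Proof. by move=> If; rewrite unlock fineK// integrable_fin_num. Qed.

Definition sqint f := measurable_fun setT f /\ integ (fun w => f w ^+ 2).

Lemma Lfun2P f : f \in Lfun P 2%:E <-> sqint f.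
Proof.
split=> [L2f|[mf /integrableP[_ If]]].
  split; last exact: Lfun2_integrable_sqr.
  by move: L2f; rewrite inE => /andP[]; rewrite inE.
rewrite inE; apply/andP; split; rewrite inE//=.
rewrite /finite_norm unlock /Lnorm poweR_lty//.
apply: le_lt_trans If; rewrite le_eqVlt; apply/orP; left; apply/eqP.
apply: eq_integral => w _ /=.
by rewrite powR_mulrn// real_normK ?num_real// ger0_norm// sqr_ge0.
Qed.

Lemma sqint_dom f g : measurable_fun setT f -> (forall w, f w ^+ 2 <= g w) ->
  integ g -> sqint f.
Proof.
move=> mf fg Ig; split=> //; apply: integ_dom Ig; first exact: measurable_funX.
by move=> w; rewrite ger0_norm ?sqr_ge0.
Qed.

(** Dominated by [f ^+ 2 + g ^+ 2]. *)
Lemma sqintM f g : sqint f -> sqint g -> integ (fun w => f w * g w).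
Proof.
move=> [mf If] [mg Ig]; apply: integ_dom (integD If Ig).
  exact: measurable_funM.
move=> w; rewrite normrM -[f w ^+ 2]real_normK ?num_real//.
rewrite -[g w ^+ 2]real_normK ?num_real//.
have := sqr_ge0 (`|f w| - `|g w|); have := normr_ge0 (f w).
by have := normr_ge0 (g w); nra.
Qed.

Lemma sqint_cst c : sqint (fun=> c).
Proof. by split=> //; exact: integ_cst. Qed.

Lemma sqint_integ f : sqint f -> integ f.
Proof.
move=> /sqintM /(_ (sqint_cst 1)).
by under [X in integ X]eq_fun do rewrite mulr1.
Qed.

Lemma sqintZ c f : sqint f -> sqint (fun w => c * f w).
Proof.
move=> [mf If]; split; first exact: measurable_funM.
by under [X in integ X]eq_fun do rewrite exprMn; exact: integZ.
Qed.

Lemma sqintD f g : sqint f -> sqint g -> sqint (fun w => f w + g w).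
Proof.
move=> Sf Sg; have [mf If] := Sf; have [mg Ig] := Sg.
apply: (sqint_dom _ _ (integD (integD If Ig) (integZ 2 (sqintM Sf Sg)))).
  exact: measurable_funD.
by move=> w; rewrite le_eqVlt; apply/orP; left; apply/eqP; ring.
Qed.

Lemma sqint_sum I (s : seq I) (f : I -> Omega -> R) :
  (forall i, sqint (f i)) -> sqint (fun w => \sum_(i <- s) f i w).
Proof.
move=> Sf; elim: s => [|i s IH].
  by under [X in sqint X]eq_fun do rewrite big_nil; exact: sqint_cst.
by under [X in sqint X]eq_fun do rewrite big_cons; exact: sqintD.
Qed.

Section matrices.
Variables p q : nat.
Implicit Types X Y : Omega -> 'M[R]_(p, q).

Definition sqmx X := forall i j, sqint (fun w => X w i j).

Lemma sqmxD X Y : sqmx X -> sqmx Y -> sqmx (fun w => X w + Y w).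
Proof.
move=> SX SY i j; under [X in sqint X]eq_fun do rewrite mxE.
exact: sqintD.
Qed.

Lemma sqmxZ c X : sqmx X -> sqmx (fun w => c *: X w).
Proof.
move=> SX i j; under [X in sqint X]eq_fun do rewrite mxE.
exact: sqintZ.
Qed.

Lemma sqmxN X : sqmx X -> sqmx (fun w => - X w).
Proof.
move=> SX; under [X in sqmx X]eq_fun do rewrite -scaleN1r.
exact: sqmxZ.
Qed.

Lemma sqmxMl r (A : 'M[R]_(r, p)) X i j :
  sqmx X -> sqint (fun w => (A *m X w) i j).
Proof.
move=> SX; under [X in sqint X]eq_fun do rewrite mxE.
by apply: sqint_sum => l; exact: sqintZ.
Qed.

Lemma integ_sqnorm X : sqmx X -> integ (fun w => sqnorm (X w)).
Proof.
by move=> SX; apply: integ_sum => i; apply: integ_sum => j; have [] := SX i j.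
Qed.

Lemma sqmx_dom X f : (forall i j, measurable_fun setT (fun w => X w i j)) ->
  (forall w, sqnorm (X w) <= f w) -> integ f -> sqmx X.
Proof.
move=> mX Xf If i j; apply: sqint_dom If => // w.
apply: le_trans (Xf w); rewrite /sqnorm (bigD1 i)//= (bigD1 j)//= -addrA lerDl.
by rewrite addr_ge0// sumr_ge0// => *; rewrite ?sumr_ge0// => *; exact: sqr_ge0.
Qed.

End matrices.

Lemma L2_sqmx n (X : Omega -> 'cV[R]_n) : L2 P X <-> sqmx X.
Proof.
split=> [LX i j|SX i]; last exact/Lfun2P.
by rewrite (ord1 j); exact/Lfun2P.
Qed.

End moments.

(** * Measurability with respect to a sub-sigma-algebra *)

Section adapted.
Context {R : realType} {disp : measure_display} {Omega : measurableType disp}.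
Implicit Types (G : set (set Omega)) (f g : Omega -> R).

(** Phrased on the type generated by [G], so that the closure properties of measurable functions
    apply verbatim; for a sigma-algebra [G] it is the preimage condition of [adaptedP]. *)
Definition adapted G f :=
  measurable_fun setT (f : g_sigma_algebraType G -> measurableTypeR R).

Definition adapted_mx G p q (X : Omega -> 'M[R]_(p, q)) :=
  forall i j, adapted G (fun w => X w i j).

Lemma adaptedP G f : sigma_algebra setT G ->
  adapted G f <->
  forall B : set (measurableTypeR R), measurable B -> G (f @^-1` B).
Proof.
move=> sG; split=> [mf B mB|mf _ B mB]; rewrite ?setTI.
  have := mf measurableT B mB; rewrite setTI.
  by rewrite measurable_g_measurableTypeE.
by rewrite measurable_g_measurableTypeE//; exact: mf.
Qed.

Lemma adapted_mx_measurable G p q (X : Omega -> 'M[R]_(p, q)) :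
  sigma_algebra setT G -> adapted_mx G X <-> mx_measurable G X.
Proof.
move=> sG; split=> [aX i j _ [B mB <-]|mX i j].
  by rewrite setTI; have /(adaptedP _ sG) := aX i j; exact.
by apply/(adaptedP _ sG) => B mB; apply: (mX i j); exists B; rewrite ?setTI.
Qed.

Lemma adapted_measurable G f :
  sigma_algebra setT G -> G `<=` measurable -> adapted G f ->
  measurable_fun setT f.
Proof.
by move=> sG GM /(adaptedP _ sG) mf _ B mB; rewrite setTI; exact/GM/mf.
Qed.

Lemma adaptedS G H f : sigma_algebra setT G -> sigma_algebra setT H ->
  G `<=` H -> adapted G f -> adapted H f.
Proof.
move=> sG sH GH /(adaptedP _ sG) mf; apply/(adaptedP _ sH) => B mB.
exact/GH/mf.
Qed.

Lemma adapted_cst G c : adapted G (fun=> c).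
Proof. exact: measurable_cst. Qed.

Lemma adaptedD G f g : adapted G f -> adapted G g ->
  adapted G (fun w => f w + g w).
Proof. by move=> af ag; apply: measurable_funD. Qed.

Lemma adaptedM G f g : adapted G f -> adapted G g ->
  adapted G (fun w => f w * g w).
Proof. by move=> af ag; apply: measurable_funM. Qed.

Lemma adapted_sum G I (s : seq I) (f : I -> Omega -> R) :
  (forall i, adapted G (f i)) -> adapted G (fun w => \sum_(i <- s) f i w).
Proof. by move=> af; exact: measurable_sum. Qed.

Lemma adapted_comp G f (h : measurableTypeR R -> measurableTypeR R) :
  measurable_fun setT h -> adapted G f -> adapted G (fun w => h (f w)).
Proof. by move=> mh af; exact: measurableT_comp. Qed.

Lemma adapted_runmax G (f : nat -> Omega -> R) n :
  (forall i, (i <= n)%N -> adapted G (f i)) ->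
  adapted G (fun w => runmax (fun i => f i w) n).
Proof.
elim: n => [|n IH] af.
  rewrite /runmax; under eq_fun do rewrite big_ord_recl big_ord0.
  by apply: measurable_maxr; [exact: af|exact: measurable_cst].
under [X in adapted _ X]eq_fun do rewrite runmaxS.
apply: measurable_maxr; last exact: af.
by apply: IH => i lin; apply: af; exact: leqW.
Qed.

Lemma measurable_sg1 :
  measurable_fun setT (sg1 : measurableTypeR R -> measurableTypeR R).
Proof.
apply: measurable_funB => //; apply: measurable_funM => //.
apply: measurable_indic.
by rewrite -set_itvcy; exact: measurable_itv.
Qed.

Lemma adapted_mxD G p q (X Y : Omega -> 'M[R]_(p, q)) :
  adapted_mx G X -> adapted_mx G Y -> adapted_mx G (fun w => X w + Y w).
Proof.
move=> aX aY i j; under [X in adapted _ X]eq_fun do rewrite mxE.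
exact: adaptedD.
Qed.

Lemma adapted_mxM G p q r (X : Omega -> 'M[R]_(p, q))
    (Y : Omega -> 'M[R]_(q, r)) :
  adapted_mx G X -> adapted_mx G Y -> adapted_mx G (fun w => X w *m Y w).
Proof.
move=> aX aY i j; under [X in adapted _ X]eq_fun do rewrite mxE.
by apply: adapted_sum => l; exact: adaptedM.
Qed.

Lemma adapted_mxZ G p q c (X : Omega -> 'M[R]_(p, q)) :
  adapted_mx G X -> adapted_mx G (fun w => c *: X w).
Proof.
move=> aX i j; under [X in adapted _ X]eq_fun do rewrite mxE.
by apply: adaptedM => //; exact: adapted_cst.
Qed.

Lemma adapted_mx_cst G p q (A : 'M[R]_(p, q)) : adapted_mx G (fun=> A).
Proof. by move=> i j; exact: adapted_cst. Qed.

(** Joint Borel measurability is composed with w -> (t, X w), which takes values in the measurable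
    half-space of nonnegative times. *)
Lemma adapted_mx_coefficient G d p q (f : R -> 'cV[R]_d -> 'M[R]_(p, q)) t
    (X : Omega -> 'cV[R]_d) : borel_coefficient f -> 0 <= t ->
  adapted_mx G X -> adapted_mx G (fun w => f t (X w)).
Proof.
move=> mf t0 aX i j.
pose z (w : g_sigma_algebraType G) :
    measurableTypeR R * d.-tuple (measurableTypeR R) :=
  (t, [tuple X w l 0 | l < d]).
have mz : measurable_fun setT z.
  apply: measurable_fun_pair; first exact: measurable_cst.
  apply/measurable_fun_tnthP => l /=.
  rewrite (_ : _ \o _ = fun w => X w l 0); first exact: aX.
  by apply/funext => w /=; rewrite tnth_mktuple.
rewrite (_ : (fun w => _) = (fun u :
    measurableTypeR R * d.-tuple (measurableTypeR R) =>
    f u.1 (\col_l tnth u.2 l) i j) \o z); last first.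
  apply/funext => w /=; congr (f t _ i j).
  by apply/matrixP => l l'; rewrite mxE tnth_mktuple (ord1 l').
apply: (measurable_comp _ _ (mf i j) mz).
  rewrite (_ : [set _ | _] = `[0, +oo[ `*` setT).
    exact: measurableX.
  by apply/seteqP; split=> [u /= u0|u [/=]]; rewrite in_itv/= andbT.
by move=> _ [w _ <-].
Qed.

End adapted.

(** * Brownian increments *)

Section gaussian_noise.
Context {R : realType} {disp : measure_display} {Omega : measurableType disp}.
Variable P : probability Omega R.

Lemma ge0_integ (f : Omega -> R) : measurable_fun setT f ->
  (forall w, 0 <= f w) -> (\int[P]_w (f w)%:E < +oo)%E -> integ P f.
Proof.
move=> mf f0 foo; apply/integrableP; split; first exact/measurable_EFinP.
by under eq_integral => w _ do rewrite /= ger0_norm//.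
Qed.

Lemma independent_mean (X Z : Omega -> measurableTypeR R)
    (f g : measurableTypeR R -> measurableTypeR R) :
  measurable_fun setT X -> measurable_fun setT Z ->
  (forall A B : set (measurableTypeR R), measurable A -> measurable B ->
    P (X @^-1` A `&` Z @^-1` B) = (P (X @^-1` A) * P (Z @^-1` B))%E) ->
  measurable_fun setT f -> (forall x, 0 <= f x) ->
  measurable_fun setT g -> (forall x, 0 <= g x) ->
  integ P (f \o X) -> integ P (g \o Z) ->
  integ P (fun w => f (X w) * g (Z w)) /\
  mean P (fun w => f (X w) * g (Z w)) = mean P (f \o X) * mean P (g \o Z).
Proof.
move=> mX mZ XZ mf f0 mg g0 IfX IgZ.
have E : (\int[P]_w (f (X w) * g (Z w))%:E =
    (mean P (f \o X))%:E * (mean P (g \o Z))%:E)%E.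
  under eq_integral => w _ do rewrite EFinM.
  have mEf : measurable_fun setT (EFin \o f) by exact/measurable_EFinP.
  have mEg : measurable_fun setT (EFin \o g) by exact/measurable_EFinP.
  have Ef0 x : (0 <= (EFin \o f) x)%E by rewrite /= lee_fin.
  have Eg0 x : (0 <= (EFin \o g) x)%E by rewrite /= lee_fin.
  rewrite (independent_ge0_integralM mX mZ XZ mEf Ef0 mEg Eg0).
  by rewrite !fineK// integrable_fin_num.
split; last by rewrite {1}/mean /Rintegral E -EFinM.
apply: ge0_integ; last by rewrite E -EFinM ltry.
  by apply: measurable_funM; apply: measurableT_comp.
by move=> w; rewrite mulr_ge0 ?f0 ?g0.
Qed.

Definition has_normal_law (s : R) (Z : Omega -> measurableTypeR R) :=
  measurable_fun setT Z /\
  forall B : set (measurableTypeR R), measurable B ->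
    P (Z @^-1` B) = normal_prob 0 s B.

Lemma normal_law_integral s Z (g : measurableTypeR R -> \bar R) :
  has_normal_law s Z -> measurable_fun setT g -> (forall x, (0 <= g x)%E) ->
  (\int[P]_w g (Z w) = \int[normal_prob 0 s]_x g x)%E.
Proof.
move=> [mZ ZE] mg g0.
pose Z' : {RV P >-> measurableTypeR R} := mfun_Sub (mem_set mZ).
rewrite -[LHS](ge0_integral_distribution Z')//.
by apply: eq_measure_integral => B mB _; exact: ZE.
Qed.

Lemma normal_law_sqint s Z : 0 < s -> has_normal_law s Z ->
  sqint P Z /\ mean P (fun w => Z w ^+ 2) <= 4 * Num.sqrt 2 * s ^+ 2.
Proof.
move=> s0 ZN; have [mZ _] := ZN.
have le : (\int[P]_w (Z w ^+ 2)%:E <= (4 * Num.sqrt 2 * s ^+ 2)%:E)%E.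
  have mS : measurable_fun setT (fun x : measurableTypeR R => (x ^+ 2)%:E).
    by apply/measurable_EFinP; exact: measurable_funX.
  have S0 (x : measurableTypeR R) : (0 <= (x ^+ 2)%:E)%E.
    by rewrite lee_fin sqr_ge0.
  by rewrite (normal_law_integral ZN mS S0) normal_prob_sqr_le.
have SZ : sqint P Z.
  split=> //; apply: ge0_integ; first exact: measurable_funX.
  - by move=> w; exact: sqr_ge0.
  - exact: le_lt_trans le (ltry _).
split=> //; rewrite -lee_fin; move: le.
by rewrite -[X in (X <= _)%E -> _]fineK//; apply: integrable_fin_num; case: SZ.
Qed.

Lemma normal_law_symmetric s Z (g : measurableTypeR R -> measurableTypeR R) :
  s != 0 -> has_normal_law s Z ->
  measurable_fun setT g -> (forall x, 0 <= g x) ->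
  mean P (g \o Z) = mean P (g \o (fun w => - Z w)).
Proof.
move=> s0 ZN mg g0; have [mZ ZE] := ZN.
have ZN' : has_normal_law s (fun w => - Z w).
  split; first exact: measurableT_comp.
  move=> B mB.
  have mB' : measurable (-%R @^-1` B : set (measurableTypeR R)).
    rewrite -[_ @^-1` _]setTI.
    exact: (@oppr_measurable _ setT).
  by rewrite -normal_probN// -ZE.
have g0' x : (0 <= (EFin \o g) x)%E by rewrite /= lee_fin g0.
have mg' : measurable_fun setT (EFin \o g) by exact/measurable_EFinP.
by congr fine; rewrite (normal_law_integral ZN mg' g0')
  (normal_law_integral ZN' mg' g0').
Qed.

Variable m : nat.

(* All that is used of Brownian increments: their independence of the past and
   their Gaussian law enter only through these two conditional moments. *)
Record noise (G : nat -> set (set Omega)) (D : nat -> Omega -> 'cV[R]_m)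
    (kappa : R) : Prop := {
  noise_sigma : forall n, sigma_algebra setT (G n);
  noise_sub : forall n, G n `<=` measurable;
  noise_incr : forall n, G n `<=` G n.+1;
  noise_adapted : forall n, adapted_mx (G n.+1) (D n);
  noise_mean0 : forall n j xi, adapted (G n) xi -> integ P xi ->
    integ P (fun w => xi w * D n w j 0) /\
    mean P (fun w => xi w * D n w j 0) = 0;
  noise_sqr : forall n j xi, adapted (G n) xi -> integ P xi ->
    (forall w, 0 <= xi w) ->
    integ P (fun w => xi w * D n w j 0 ^+ 2) /\
    mean P (fun w => xi w * D n w j 0 ^+ 2) <= kappa * mean P xi }.

Variables (F : R -> set (set Omega)) (W : R -> Omega -> 'cV[R]_m).
Hypotheses (hF : usual_conditions P F) (hW : brownian_motion P F W).

Lemma increment_normal_law s t j : 0 <= s -> s < t ->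
  has_normal_law (Num.sqrt (t - s)) (fun w => (W t w - W s w) j 0).
Proof.
move=> s0 st; have t0 : 0 <= t by rewrite (le_trans s0)// ltW.
have mW u : 0 <= u -> measurable_fun setT (fun w => W u w j 0 : measurableTypeR R).
  move=> u0; have sF := uc_sigma_algebra hF u0.
  apply: (adapted_measurable sF (uc_measurable hF u0)).
  by have /(adapted_mx_measurable _ sF) := bm_adapted hW u0; exact.
split.
  under eq_fun do rewrite !mxE.
  by apply: measurable_funB; exact: mW.
move=> B mB.
(* The law of one coordinate is read off the joint law by leaving the other coordinates free. *)
pose C (i : 'I_m) : set (measurableTypeR R) := if i == j then B else setT.
have mC i : measurable (C i) by rewrite /C; case: ifP.
have := bm_gaussian hW s0 st mC.
rewrite (bigD1 j)//= [X in (_ * X)%E]big1 ?mule1 => [|i ij].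
  rewrite {2}/C eqxx => <-; congr (P _).
  apply/seteqP; split=> [w Bw i|w /(_ j)]; rewrite /C.
    by case: eqP => [->|].
  by rewrite eqxx.
by rewrite /C (negbTE ij) probability_setT.
Qed.

Lemma increment_independent s t j (X : Omega -> measurableTypeR R) :
  0 <= s -> s < t -> adapted (F s) X ->
  forall A B : set (measurableTypeR R), measurable A -> measurable B ->
  P (X @^-1` A `&` (fun w => (W t w - W s w) j 0) @^-1` B) =
  (P (X @^-1` A) * P ((fun w => ((W t w - W s w) j 0)%R) @^-1` B))%E.
Proof.
move=> s0 st /(adaptedP _ (uc_sigma_algebra hF s0)) aX A B mA mB.
apply: (bm_independent hW s0 st); first exact: aX.
apply: sub_sigma_algebra; exists j => //.
by exists B; rewrite ?setTI.
Qed.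

Lemma measurable_posr :
  measurable_fun setT (fun x : measurableTypeR R => Num.max x 0 : measurableTypeR R).
Proof. by apply: measurable_maxr; [exact: measurable_id|exact: measurable_cst]. Qed.

(** The factor 4 sqrt 2 is that of the Gaussian comparison in [normal_prob_sqr_le]; what matters for
    the rate is that the variance bound is linear in [dt]. *)
Lemma brownian_noise dt : 0 < dt ->
  noise (fun n => F (n%:R * dt)) (increment W dt) (4 * Num.sqrt 2 * dt).
Proof.
move=> dt0.
have t0 n : 0 <= n%:R * dt by rewrite mulr_ge0// ltW.
have tS n : n.+1%:R * dt - n%:R * dt = dt.
  by rewrite -mulrBl -natrB// subSnn mul1r.
have tlt n : n%:R * dt < n.+1%:R * dt by rewrite -subr_gt0 tS.
have sF n := uc_sigma_algebra hF (t0 n).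
have FS n : F (n%:R * dt) `<=` F (n.+1%:R * dt).
  by apply: (uc_increasing hF); [exact: t0|exact/ltW/tlt].
have law n j : has_normal_law (Num.sqrt dt) (fun w => increment W dt n w j 0).
  by have := increment_normal_law j (t0 n) (tlt n); rewrite tS.
have sdt : 0 < Num.sqrt dt by rewrite sqrtr_gt0.
have SD n j := (normal_law_sqint sdt (law n j)).1.
have MD n j := (normal_law_sqint sdt (law n j)).2.
have indep n j xi : adapted (F (n%:R * dt)) xi ->
    forall A B : set (measurableTypeR R), measurable A -> measurable B ->
    P (xi @^-1` A `&` (fun w => increment W dt n w j 0) @^-1` B) =
    (P (xi @^-1` A) * P ((fun w => increment W dt n w j 0%R) @^-1` B))%E.
  by move=> axi; exact: increment_independent.
split.
- exact: sF.
- by move=> n; exact: (uc_measurable hF).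
- exact: FS.
- move=> n.
  have aW k : adapted_mx (F (k%:R * dt)) (W (k%:R * dt)).
    by apply/(adapted_mx_measurable _ (sF k)); exact: (bm_adapted hW).
  apply: adapted_mxD; first exact: aW.
  have aWn : adapted_mx (F (n.+1%:R * dt)) (W (n%:R * dt)).
    move=> i j; apply: (adaptedS (sF n) (sF n.+1)) (FS n) _; exact: aW.
  under [X in adapted_mx _ X]eq_fun do rewrite -scaleN1r.
  exact: adapted_mxZ.
- move=> n j xi axi Ixi.
  (* The product rule is available for nonnegative functions, so both factors are split into
     positive and negative parts. *)
  pose p (x : measurableTypeR R) : measurableTypeR R := Num.max x 0.
  pose q (x : measurableTypeR R) : measurableTypeR R := p (- x).
  have pq x : x = p x - q x.
    by rewrite /q /p; case: (ltP x 0) => ?; case: ltP => ?; lra.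
  have mp : measurable_fun setT p := measurable_posr.
  have mq : measurable_fun setT q by exact: measurableT_comp.
  have p0 x : 0 <= p x by rewrite le_max lexx orbT.
  have q0 x : 0 <= q x by exact: p0.
  have px x : p x <= `|x| by rewrite ge_max ler_norm normr_ge0.
  have qx x : q x <= `|x| by rewrite -normrN px.
  have Ih (h : measurableTypeR R -> measurableTypeR R) (f : Omega -> R) :
      measurable_fun setT h -> (forall x, 0 <= h x) -> (forall x, h x <= `|x|) ->
      integ P f -> integ P (h \o f).
    move=> mh h0 hx If; apply: integ_dom (integ_norm If).
      exact: measurableT_comp (integ_measurable If).
    by move=> w /=; rewrite ger0_norm.
  set Z := fun w => increment W dt n w j 0.
  have IZ : integ P Z by exact: sqint_integ (SD n j).
  have prod h1 h2 m1 g1 x1 m2 g2 x2 := @independent_mean xi Z h1 h2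
    (integ_measurable Ixi) (law n j).1 (indep n j xi axi) m1 g1 m2 g2
    (Ih h1 xi m1 g1 x1 Ixi) (Ih h2 Z m2 g2 x2 IZ).
  have [Ipp Epp] := prod p p mp p0 px mp p0 px.
  have [Ipq Epq] := prod p q mp p0 px mq q0 qx.
  have [Iqp Eqp] := prod q p mq q0 qx mp p0 px.
  have [Iqq Eqq] := prod q q mq q0 qx mq q0 qx.
  have sym : mean P (p \o Z) = mean P (q \o Z).
    by apply: (normal_law_symmetric _ (law n j)); rewrite ?gt_eqF.
  (* By symmetry the two parts of [Z] have equal means, so the four factored products cancel in
     pairs. *)
  have E : (fun w => xi w * Z w) = (fun w =>
      (p (xi w) * p (Z w) + q (xi w) * q (Z w))
      + -1 * (p (xi w) * q (Z w) + q (xi w) * p (Z w))).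
    by apply/funext => w; rewrite {1}(pq (xi w)) {1}(pq (Z w)); ring.
  rewrite E; split; first by apply: integD (integD _ _) (integZ _ (integD _ _)).
  rewrite meanD ?meanZ ?meanD//; [|exact: integD|exact: integD|].
    by rewrite Epp Epq Eqp Eqq sym; ring.
  by apply: integZ; exact: integD.
- move=> n j xi axi Ixi xi0.
  have msqr : measurable_fun setT
      (fun x : measurableTypeR R => x ^+ 2 : measurableTypeR R).
    exact: measurable_funX.
  have mnrm : measurable_fun setT
      (fun x : measurableTypeR R => `|x| : measurableTypeR R).
    exact: normr_measurable.
  have [Ixi2 Exi2] := @independent_mean xi (fun w => increment W dt n w j 0)
    (fun x => `|x|) (fun x => x ^+ 2) (integ_measurable Ixi) (law n j).1
    (indep n j xi axi) mnrm (@normr_ge0 _ _) msqr (@sqr_ge0 _)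
    (integ_norm Ixi) (SD n j).2.
  (* The product rule asks for a function nonnegative everywhere; composing with the modulus
     supplies one and does not change the nonnegative [xi]. *)
  have normxi : (fun w => `|xi w|) = xi by apply/funext => w; rewrite ger0_norm.
  have E : (fun w => xi w * increment W dt n w j 0 ^+ 2) =
           (fun w => `|xi w| * increment W dt n w j 0 ^+ 2).
    by apply/funext => w; rewrite ger0_norm.
  rewrite E; split=> //; rewrite Exi2 [X in mean P X * _]normxi mulrC.
  by rewrite ler_wpM2r ?mean_ge0// (le_trans (MD n j))// sqr_sqrtr// ltW.
Qed.

End gaussian_noise.

(** * Doob's inequality and discrete Ito processes *)

Lemma runmax_le_sum {R : realType} (x : nat -> R) n : (forall i, 0 <= x i) ->
  runmax x n <= \sum_(i < n.+1) x i.
Proof.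
move=> x0; apply: runmax_le => [|i lin]; first exact: sumr_ge0.
rewrite (bigD1 (Ordinal (lin : (i < n.+1)%N)))//= lerDl.
by apply: sumr_ge0.
Qed.

Section integrable_max.
Context {R : realType} {disp : measure_display} {Omega : measurableType disp}.
Variable P : probability Omega R.

Lemma integ_max (f g : Omega -> R) : integ P f -> integ P g ->
  integ P (fun w => Num.max (f w) (g w)).
Proof.
move=> If Ig; apply: integ_dom (integD (integ_norm If) (integ_norm Ig)).
  by apply: measurable_maxr; [exact: integ_measurable If|exact: integ_measurable Ig].
by move=> w; rewrite /Num.max; case: ifP => _; rewrite ?lerDr ?lerDl normr_ge0.
Qed.

Lemma integ_runmax (f : nat -> Omega -> R) n :
  (forall i, (i <= n)%N -> integ P (f i)) ->
  integ P (fun w => runmax (fun i => f i w) n).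
Proof.
elim: n => [|n IH] If.
  rewrite /runmax; under [X in integ _ X]eq_fun do rewrite big_ord_recl big_ord0.
  by apply: integ_max; [exact: If|exact: integ_cst].
under [X in integ _ X]eq_fun do rewrite runmaxS.
apply: integ_max; last exact: If.
by apply: IH => i lin; apply: If; exact: leqW.
Qed.

End integrable_max.

Section noise_sums.
Context {R : realType} {disp : measure_display} {Omega : measurableType disp}.
Variables (P : probability Omega R) (m : nat) (G : nat -> set (set Omega)).
Variables (D : nat -> Omega -> 'cV[R]_m) (kappa : R).
Hypothesis nz : noise P G D kappa.

Lemma noise_filtration i n : (i <= n)%N -> G i `<=` G n.
Proof.
elim: n => [|n IH]; first by rewrite leqn0 => /eqP->.
rewrite leq_eqVlt => /predU1P[->//|]; rewrite ltnS => /IH GiGn.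
by move=> A /GiGn; exact: (noise_incr nz).
Qed.

Lemma noise_adaptedS i n (f : Omega -> R) :
  (i <= n)%N -> adapted (G i) f -> adapted (G n) f.
Proof.
by move=> lin; apply: adaptedS (noise_filtration lin); exact: noise_sigma nz _.
Qed.

Lemma noise_measurable n (f : Omega -> R) :
  adapted (G n) f -> measurable_fun setT f.
Proof.
by apply: adapted_measurable; [exact: noise_sigma nz _|exact: noise_sub nz _].
Qed.

Lemma noise_sqint n j (h : Omega -> R) : adapted (G n) h -> sqint P h ->
  sqint P (fun w => h w * D n w j 0) /\
  mean P (fun w => (h w * D n w j 0) ^+ 2) <= kappa * mean P (fun w => h w ^+ 2).
Proof.
move=> ah [mh Ih].
have ah2 : adapted (G n) (fun w => h w ^+ 2).
  by under eq_fun do rewrite expr2; exact: adaptedM.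
have [I2 E2] := noise_sqr nz j ah2 Ih (fun w => sqr_ge0 (h w)).
have E : (fun w => (h w * D n w j 0) ^+ 2) = (fun w => h w ^+ 2 * D n w j 0 ^+ 2).
  by apply/funext => w; rewrite exprMn.
split; last by rewrite E.
split; last by rewrite E.
by apply: measurable_funM => //; exact: noise_measurable (noise_adapted nz j 0).
Qed.

(** * Martingale transforms of the noise *)

Section martingale.
Variables (N : nat) (h : nat -> 'I_m -> Omega -> R).
Hypothesis ah : forall i j, (i < N)%N -> adapted (G i) (h i j).
Hypothesis Sh : forall i j, (i < N)%N -> sqint P (h i j).

Definition mart_incr i w := \sum_j h i j w * D i w j 0.
(** The last increment used is [D n.-1], which is known at time [n]; hence [mart n] is [G n]-adapted
    while [mart_incr n] is orthogonal to [G n]. *)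
Definition mart n w := \sum_(i < n) mart_incr i w.

Lemma mart_incr_sqint i : (i < N)%N -> sqint P (mart_incr i).
Proof.
move=> iN; apply: sqint_sum => j.
by have [] := noise_sqint j (ah j iN) (Sh j iN).
Qed.

(** The weight [xi * h i j] is still [G i]-adapted, and integrable as a product of square-integrable
    variables, so each coordinate of the noise averages to zero against it. *)
Lemma mart_incr_orth i (xi : Omega -> R) :
  (i < N)%N -> adapted (G i) xi -> sqint P xi ->
  mean P (fun w => xi w * mart_incr i w) = 0.
Proof.
move=> iN axi Sxi.
under [X in mean P X]eq_fun do rewrite mulr_sumr.
have H j := noise_mean0 nz j (adaptedM axi (ah j iN)) (sqintM Sxi (Sh j iN)).
have E j : (fun w => xi w * (h i j w * D i w j 0)) =
           (fun w => xi w * h i j w * D i w j 0).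
  by apply/funext => w; rewrite mulrA.
rewrite mean_sum => [|j]; last by rewrite E; exact: (H j).1.
by rewrite big1// => j _; rewrite E (H j).2.
Qed.

(** [noise] controls the coordinates one at a time and says nothing of their correlations;
    Cauchy-Schwarz over the [m] coordinates gives the factor [m]. *)
Lemma mart_incr_var i : (i < N)%N ->
  mean P (fun w => mart_incr i w ^+ 2) <=
  m%:R * kappa * \sum_j mean P (fun w => h i j w ^+ 2).
Proof.
move=> iN; have S j := noise_sqint j (ah j iN) (Sh j iN).
have I2 j : integ P (fun w => (h i j w * D i w j 0) ^+ 2) by have [[]] := S j.
apply: (@le_trans _ _
    (mean P (fun w => m%:R * \sum_j (h i j w * D i w j 0) ^+ 2))).
  apply: le_mean => [||w]; last exact: sqr_sum_le.
    by have [] := mart_incr_sqint iN.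
  by apply: integZ; exact: integ_sum.
rewrite meanZ; last exact: integ_sum.
rewrite mean_sum// -mulrA ler_wpM2l// mulr_sumr; apply: ler_sum => j _.
by have [] := S j.
Qed.

Lemma mart_adapted n : (n <= N)%N -> adapted (G n) (mart n).
Proof.
elim: n => [|n IH] nN.
  by rewrite /mart; under eq_fun do rewrite big_ord0; exact: adapted_cst.
rewrite /mart; under [X in adapted _ X]eq_fun do rewrite big_ord_recr /=.
apply: adaptedD; first exact: noise_adaptedS (IH (ltnW nN)).
apply: adapted_sum => j; apply: adaptedM; last exact: (noise_adapted nz).
by apply: noise_adaptedS (ah j nN).
Qed.

Lemma mart_sqint n : (n <= N)%N -> sqint P (mart n).
Proof.
elim: n => [|n IH] nN.
  by rewrite /mart; under eq_fun do rewrite big_ord0; exact: sqint_cst.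
rewrite /mart; under [X in sqint _ X]eq_fun do rewrite big_ord_recr /=.
by apply: sqintD; [exact: IH (ltnW nN)|exact: mart_incr_sqint].
Qed.

Lemma mart_var n : (n <= N)%N ->
  mean P (fun w => mart n w ^+ 2) <=
  m%:R * kappa * \sum_(i < n) \sum_j mean P (fun w => h i j w ^+ 2).
Proof.
elim: n => [|n IH] nN.
  rewrite /mart; under [X in mean P X]eq_fun do rewrite big_ord0 expr0n.
  by rewrite mean_cst big_ord0 mulr0.
have E : (fun w => mart n.+1 w ^+ 2) = (fun w =>
    (mart n w ^+ 2 + 2 * (mart n w * mart_incr n w)) + mart_incr n w ^+ 2).
  by apply/funext => w; rewrite /mart big_ord_recr /=; ring.
have SM := mart_sqint (ltnW nN); have SI := mart_incr_sqint nN.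
have IMI := sqintM SM SI.
have I2 := integZ 2 IMI.
rewrite E (meanD (integD SM.2 I2) SI.2) (meanD SM.2 I2) (meanZ 2 IMI).
rewrite (mart_incr_orth nN (mart_adapted (ltnW nN)) SM).
rewrite mulr0 addr0 big_ord_recr /= mulrDr.
by rewrite lerD ?mart_incr_var// IH// ltnW.
Qed.

(** The mean of [doob_pathwise]: its sum is again a martingale transform, with adapted integrand
    [q * sg1 mart], and so has mean zero. The variance of [mart n] remains. *)
Lemma doob_L2 n : (n <= N)%N ->
  integ P (fun w => runmax (fun i => mart i w ^+ 2) n) /\
  mean P (fun w => runmax (fun i => mart i w ^+ 2) n) <=
  4 * (m%:R * kappa * \sum_(i < n) \sum_j mean P (fun w => h i j w ^+ 2)).
Proof.
move=> nN.
have IS k : (k <= N)%N -> integ P (fun w => \sum_(i < k.+1) mart i w ^+ 2).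
  move=> kN; apply: integ_sum => i.
  have iN : (i <= N)%N by apply: leq_trans kN; rewrite -ltnS.
  by have [] := mart_sqint iN.
have amax (f : nat -> Omega -> R) k : (k <= N)%N ->
    (forall i, (i <= k)%N -> adapted (G i) (f i)) ->
    adapted (G k) (fun w => runmax (fun i => f i w) k).
  move=> kN af; apply: adapted_runmax => i ik.
  exact: noise_adaptedS ik (af i ik).
have aM i k : (i <= k)%N -> (k <= N)%N -> adapted (G i) (mart i).
  by move=> ik kN; exact: mart_adapted (leq_trans ik kN).
have Imax : integ P (fun w => runmax (fun i => mart i w ^+ 2) n).
  apply: (@integ_runmax _ _ _ P (fun i w => mart i w ^+ 2)) => i lin.
  by have [] := mart_sqint (leq_trans lin nN).
split=> //.
pose q k w := runmax (fun i => `|mart i w|) k.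
have aq k : (k <= N)%N -> adapted (G k) (q k).
  move=> kN; apply: (amax (fun i w => `|mart i w|)) => // i ik.
  by apply: (adapted_comp (@normr_measurable R setT)); exact: aM ik kN.
(* Square integrability of the running maximum must be known beforehand; the crude sum of squares
   provides it. *)
have q2 k w : q k w ^+ 2 <= \sum_(i < k.+1) mart i w ^+ 2.
  have s0 : 0 <= \sum_(i < k.+1) mart i w ^+ 2.
    by apply: sumr_ge0 => i _; exact: sqr_ge0.
  rewrite -[leRHS]sqr_sqrtr// lerXn2r ?nnegrE ?runmax_ge0 ?sqrtr_ge0//.
  apply: runmax_le => [|i ik]; first exact: sqrtr_ge0.
  rewrite -sqrtr_sqr ler_wsqrtr//.
  apply: le_trans (runmax_le_sum k (fun i => sqr_ge0 (mart i w))).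
  exact: (le_runmax (fun i => mart i w ^+ 2)).
have Sq k : (k <= N)%N -> sqint P (q k).
  move=> kN; apply: sqint_dom (q2 k) (IS k kN).
  exact: noise_measurable (aq k kN).
pose xi k w := q k w * sg1 (mart k w).
have axi k : (k <= N)%N -> adapted (G k) (xi k).
  move=> kN; apply: adaptedM; first exact: aq.
  by apply: (adapted_comp measurable_sg1); exact: mart_adapted.
have Sxi k : (k <= N)%N -> sqint P (xi k).
  move=> kN; have [_ Iq] := Sq k kN; apply: sqint_dom Iq.
    exact: noise_measurable (axi k kN).
  move=> w; rewrite exprMn -[sg1 _ ^+ 2]real_normK ?num_real//.
  by rewrite normr_sg1 expr1n mulr1.
have iN (i : 'I_n) : (i < N)%N by exact: leq_trans (ltn_ord i) nN.
have Ixi (i : 'I_n) : integ P (fun w => xi i w * mart_incr i w).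
  by apply: sqintM; [exact: Sxi (ltnW (iN i))|exact: mart_incr_sqint].
have [_ IM] := mart_sqint nN.
apply: (@le_trans _ _ (mean P (fun w => 4 * mart n w ^+ 2 +
    (-4) * \sum_(i < n) xi i w * mart_incr i w))).
  apply: le_mean => // [|w].
    by apply: integD; apply: integZ => //; exact: integ_sum.
  apply: le_trans (runmax_sqr (mart ^~ w) n) _.
  apply: le_trans (doob_pathwise (mart ^~ w) n) _.
  rewrite mulNr lerB// ler_wpM2l//; apply: ler_sum => i _.
  by rewrite /xi /mart big_ord_recr /= addrAC subrr add0r.
have IS' := integ_sum (index_enum _) Ixi.
rewrite (meanD (integZ 4 IM) (integZ (-4) IS')) (meanZ 4 IM) (meanZ (-4) IS').
rewrite mean_sum// big1 ?mulr0 ?addr0 => [|i _].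
  by rewrite ler_wpM2l// mart_var.
by apply: mart_incr_orth => //;
  [exact: axi (ltnW (iN i))|exact: Sxi (ltnW (iN i))].
Qed.

End martingale.

(** * Maximal moments of discrete Ito processes *)

Section processes.
Variables (d N : nat) (dt : R).
Variables (Z g : nat -> Omega -> 'cV[R]_d) (H : nat -> Omega -> 'M[R]_(d, m)).
Hypothesis ZS : forall n w, (n < N)%N ->
  Z n.+1 w = Z n w + dt *: g n w + H n w *m D n w.
Hypotheses (SZ0 : sqmx P (Z 0%N)) (Sg : forall n, (n < N)%N -> sqmx P (g n)).
Hypotheses (aH : forall n, (n < N)%N -> adapted_mx (G n) (H n))
  (SH : forall n, (n < N)%N -> sqmx P (H n)).

Let M r n w := mart (fun i j w => H i w r j) n w.

Lemma process_sum n w : (n <= N)%N ->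
  Z n w = Z 0%N w + dt *: \sum_(i < n) g i w + \col_r M r n w.
Proof.
elim: n => [|n IH] nN.
  rewrite big_ord0 scaler0 addr0; apply/matrixP => i j.
  by rewrite !mxE /M /mart big_ord0 addr0 (ord1 j).
rewrite ZS// IH ?(ltnW nN)// big_ord_recr /= scalerDr.
apply/matrixP => i j; rewrite !mxE /M /mart big_ord_recr /= (ord1 j).
rewrite /mart_incr; ring.
Qed.

(** The 3 comes from splitting into initial value, drift and noise; Cauchy-Schwarz in time gives N
    dt^2 for the drift; 12 is 3 times Doob's 4, applied row by row. It serves both Euler-Maruyama
    and the error process. *)
Lemma process_max_bound n : (n <= N)%N ->
  integ P (fun w => runmax (fun i => sqnorm (Z i w)) n) /\
  mean P (fun w => runmax (fun i => sqnorm (Z i w)) n) <=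
    3 * mean P (fun w => sqnorm (Z 0%N w))
    + 3 * N%:R * dt ^+ 2 * \sum_(i < n) mean P (fun w => sqnorm (g i w))
    + 12 * m%:R * kappa * \sum_(i < n) mean P (fun w => sqnorm (H i w)).
Proof.
move=> nN.
have iN (i : 'I_n) : (i < N)%N by exact: leq_trans (ltn_ord i) nN.
have ah r i j : (i < N)%N -> adapted (G i) (fun w => H i w r j).
  by move=> /aH; exact.
have Sh r i j : (i < N)%N -> sqint P (fun w => H i w r j).
  by move=> /SH; exact.
have doob r := doob_L2 (ah r) (Sh r) nN.
pose B w := (3 * sqnorm (Z 0%N w)
   + 3 * N%:R * dt ^+ 2 * \sum_(i < n) sqnorm (g i w))
   + 3 * \sum_r runmax (fun i => M r i w ^+ 2) n.
have Ig (i : 'I_n) : integ P (fun w => sqnorm (g i w)).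
  by apply: integ_sqnorm; exact: Sg.
have IZ0 := integ_sqnorm SZ0.
have I1 : integ P (fun w => 3 * sqnorm (Z 0%N w)) by exact: integZ.
have I2 : integ P (fun w => 3 * N%:R * dt ^+ 2 * \sum_(i < n) sqnorm (g i w)).
  by apply: integZ; exact: integ_sum.
have I3' : integ P (fun w => \sum_r runmax (fun i => M r i w ^+ 2) n).
  by apply: integ_sum => r; have [] := doob r.
have I3 : integ P (fun w => 3 * \sum_r runmax (fun i => M r i w ^+ 2) n).
  exact: integZ.
have IB : integ P B by apply: integD => //; exact: integD.
have sqnorm3 (x y z : 'cV[R]_d) :
    sqnorm (x + y + z) <= 3 * sqnorm x + 3 * sqnorm y + 3 * sqnorm z.
  rewrite !mulr_sumr -!big_split; apply: ler_sum => i _ /=.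
  rewrite !big_ord1 !mxE.
  have := sqr_ge0 (x i 0 - y i 0); have := sqr_ge0 (y i 0 - z i 0).
  by have := sqr_ge0 (x i 0 - z i 0); nra.
have le_B w : runmax (fun i => sqnorm (Z i w)) n <= B w.
  have R0 : 0 <= 3 * \sum_r runmax (fun i => M r i w ^+ 2) n.
    by rewrite mulr_ge0// sumr_ge0// => r _; exact: runmax_ge0.
  have S0 : 0 <= \sum_(i < n) sqnorm (g i w).
    by apply: sumr_ge0 => i _; exact: sqnorm_ge0.
  apply: runmax_le => [|i lin].
    have c0 : 0 <= 3 * N%:R * dt ^+ 2 by rewrite mulr_ge0 ?sqr_ge0// mulr_ge0.
    by rewrite addr_ge0// addr_ge0// mulr_ge0// sqnorm_ge0.
  rewrite process_sum ?(leq_trans lin)//.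
  apply: le_trans (sqnorm3 _ _ _) _; rewrite !lerD//.
    have -> : 3 * N%:R * dt ^+ 2 * (\sum_(i < n) sqnorm (g i w)) =
        3 * (dt ^+ 2 * (N%:R * \sum_(i < n) sqnorm (g i w))) by ring.
    rewrite sqnormZ ler_wpM2l// ler_wpM2l ?sqr_ge0//.
    apply: le_trans (sqnorm_sum _) _.
    apply: ler_pM; rewrite ?ler0n ?ler_nat ?(leq_trans lin)//.
      by apply: sumr_ge0 => l _; exact: sqnorm_ge0.
    rewrite (big_ord_widen n (fun l => sqnorm (g l w)) lin) big_mkcond /=.
    by apply: ler_sum => l _; case: ifP => // _; exact: sqnorm_ge0.
  rewrite ler_wpM2l//; apply: ler_sum => r _.
  by rewrite big_ord1 mxE (le_runmax (fun i => M r i w ^+ 2)).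
have Imax : integ P (fun w => runmax (fun i => sqnorm (Z i w)) n).
  apply: (@integ_runmax _ _ _ P (fun i w => sqnorm (Z i w))) => i lin.
  apply: integ_sqnorm => r j.
  have -> : (fun w => Z i w r j) = (fun w => Z 0%N w r 0 +
      dt * (\sum_(l < i) g l w r 0) + M r i w).
    apply/funext => w; rewrite process_sum ?(leq_trans lin)//.
    by rewrite !mxE summxE (ord1 j).
  apply: sqintD; last exact: (mart_sqint (ah r) (Sh r) (leq_trans lin nN)).
  apply: sqintD; first exact: SZ0.
  apply: sqintZ; apply: sqint_sum => l; apply: Sg.
  exact: leq_trans (ltn_ord l) (leq_trans lin nN).
split=> //; apply: le_trans (le_mean Imax IB le_B) _.
have Ig' := integ_sum (index_enum _) Ig.
rewrite /B (meanD (integD I1 I2) I3) (meanD I1 I2) (meanZ _ IZ0) (meanZ _ Ig').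
rewrite (meanZ 3 I3') (mean_sum (index_enum _) Ig).
rewrite (mean_sum (index_enum _) (fun r => (doob r).1)) lerD2l.
apply: (@le_trans _ _ (3 * \sum_r (4 * (m%:R * kappa *
    \sum_(i < n) \sum_j mean P (fun w => H i w r j ^+ 2))))).
  by rewrite ler_wpM2l//; apply: ler_sum => r _; have [] := doob r.
rewrite -!mulr_sumr exchange_big /= !mulrA.
rewrite (_ : 3 * 4 = 12 :> R); last by rewrite -natrM.
rewrite le_eqVlt; apply/orP; left; apply/eqP; congr (_ * _).
apply: eq_bigr => i _.
have IH r j : integ P (fun w => H i w r j ^+ 2) by have [] := SH (iN i) r j.
rewrite (mean_sum (index_enum _) (fun r => integ_sum (index_enum _) (IH r))).
by apply: eq_bigr => r _; rewrite (mean_sum (index_enum _) (IH r)).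
Qed.

End processes.
End noise_sums.

(** * Normal equations and the low-rank residual *)

Section second_moments.
Context {R : realType} {disp : measure_display} {Omega : measurableType disp}.
Variable P : probability Omega R.

Definition integ_mx p q (M : Omega -> 'M[R]_(p, q)) :=
  forall i j, integ P (fun w => M w i j).

Lemma emxE p q (M : Omega -> 'M[R]_(p, q)) i j :
  emx P M i j = mean P (fun w => M w i j).
Proof. by rewrite mxE unlock. Qed.

Lemma emxMl p q r (A : 'M[R]_(r, p)) (M : Omega -> 'M[R]_(p, q)) :
  integ_mx M -> emx P (fun w => A *m M w) = A *m emx P M.
Proof.
move=> IM; apply/matrixP => i j; rewrite emxE mxE.
under [X in mean P X]eq_fun do rewrite mxE.
rewrite mean_sum => [|l]; last exact: integZ.
by apply: eq_bigr => l _; rewrite emxE meanZ.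
Qed.

Lemma emxMr p q r (M : Omega -> 'M[R]_(p, q)) (A : 'M[R]_(q, r)) :
  integ_mx M -> emx P (fun w => M w *m A) = emx P M *m A.
Proof.
move=> IM; apply/matrixP => i j; rewrite emxE mxE.
have E l : (fun w => M w i l * A l j) = (fun w => A l j * M w i l).
  by apply/funext => w; rewrite mulrC.
under [X in mean P X]eq_fun do rewrite mxE.
rewrite mean_sum => [|l]; last by rewrite E; exact: integZ.
by apply: eq_bigr => l _; rewrite E emxE meanZ// mulrC.
Qed.

Lemma integ_outer n p (X : Omega -> 'cV[R]_n) (Y : Omega -> 'cV[R]_p) :
  sqmx P X -> sqmx P Y -> integ_mx (fun w => X w *m (Y w)^T).
Proof.
move=> SX SY i j.
have -> : (fun w => (X w *m (Y w)^T) i j) = (fun w => X w i 0 * Y w j 0).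
  by apply/funext => w; rewrite mxE big_ord1 mxE.
exact: sqintM.
Qed.

Lemma gramM n p (A : 'M[R]_(p, n)) (Y : Omega -> 'cV[R]_n) : sqmx P Y ->
  gram P (fun w => A *m Y w) = A *m gram P Y *m A^T.
Proof.
move=> SY; have IY := integ_outer SY SY.
rewrite /gram -emxMl// -emxMr.
  by congr emx; apply/funext => w; rewrite trmx_mul !mulmxA.
move=> i j; under [X in integ _ X]eq_fun do rewrite mxE.
by apply: integ_sum => l; exact: integZ.
Qed.

Lemma mean_ae0 (f : Omega -> R) :
  integ P f -> {ae P, forall w, f w = 0} -> mean P f = 0.
Proof.
move=> If f0; rewrite /mean /Rintegral.
have -> // : (\int[P]_w (f w)%:E = 0)%E.
rewrite -(integral0 P setT); apply: ae_eq_integral => //.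
  by apply/measurable_EFinP; exact: integ_measurable If.
by apply: filterS f0 => w fw _; rewrite fw.
Qed.

(** If [c *m Y] vanishes almost surely, so does the mean of [c *m Y *m Y^T], which is
    [c *m gram P Y]. *)
Lemma gram_lin_indep n (Y : Omega -> 'cV[R]_n) :
  sqmx P Y -> gram P Y \in unitmx -> lin_indep P Y.
Proof.
move=> SY GY c cY0.
suff cG : c *m gram P Y = 0 by rewrite -[c](mulmxK GY) cG mul0mx.
rewrite /gram -emxMl; last exact: integ_outer.
apply/matrixP => i j; rewrite emxE [RHS]mxE; apply: mean_ae0.
  under [X in integ _ X]eq_fun do rewrite mxE.
  by apply: integ_sum => l; apply: integZ; exact: integ_outer.
by apply: filterS cY0 => w cYw; rewrite mulmxA cYw mul0mx mxE.
Qed.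

(** The Gram matrix of [U^T *m Y] is [U^T *m gram P Y *m U], and [U] has full row rank. *)
Lemma gram_has_rank k d (U : 'M[R]_(k, d)) (Y : Omega -> 'cV[R]_k) :
  U *m U^T = 1%:M -> sqmx P Y -> gram P Y \in unitmx ->
  has_rank P k (fun w => U^T *m Y w).
Proof.
move=> UU SY GY; split.
  by apply/L2_sqmx => i j; exact: sqmxMl.
have Uf : row_free U by apply/row_freeP; exists U^T.
rewrite gramM// trmxK mxrankMfree// -mxrank_tr trmx_mul trmxK mxrankMfree//.
by rewrite mxrank_tr mxrank_unit.
Qed.

(** * The residual of the normal equation *)

Section residual.
Variables (k d : nat) (U : 'M[R]_(k, d)) (Y : Omega -> 'cV[R]_k).
Variables (f : Omega -> 'cV[R]_d) (V : 'M[R]_(k, d)).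
Hypotheses (SY : sqmx P Y) (Sf : sqmx P f).
Hypothesis normal_eq :
  gram P Y *m V = emx P (fun w => Y w *m (f w)^T) *m (1%:M - projU U).

(* [V^T Y] is the orthogonal projection of [(I - P_U) f] onto the span of the
   components of [Y], even when their Gram matrix is singular. *)
Definition residual w : 'cV[R]_d := (1%:M - projU U) *m f w - V^T *m Y w.

Lemma sqmx_residual : sqmx P residual.
Proof.
apply: sqmxD; first by move=> i j; exact: sqmxMl.
by apply: sqmxN => i j; exact: sqmxMl.
Qed.

(** The normal equation itself, read as orthogonality of the residual to every component of [Y]. *)
Lemma residual_orth : emx P (fun w => Y w *m (residual w)^T) = 0.
Proof.
have Iff := integ_outer SY Sf; have IYY := integ_outer SY SY.
have Ir p q r (M : Omega -> 'M[R]_(p, q)) (A : 'M[R]_(q, r)) :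
    integ_mx M -> integ_mx (fun w => M w *m A).
  move=> IM i j; under [X in integ _ X]eq_fun do rewrite mxE.
  apply: integ_sum => l.
  by under [X in integ _ X]eq_fun do rewrite mulrC; exact: integZ.
have E w : Y w *m (residual w)^T =
    Y w *m (f w)^T *m (1%:M - projU U) + -1 *: (Y w *m (Y w)^T *m V).
  have PC_tr : (1%:M - projU U)^T = 1%:M - projU U.
    by rewrite [LHS]linearB /= trmx1 projU_tr.
  rewrite /residual [(_ - _)^T]linearB /= !trmx_mul trmxK PC_tr.
  by rewrite mulmxBr scaleN1r !mulmxA.
apply/matrixP => i j; rewrite emxE [RHS]mxE.
have -> : (fun w => (Y w *m (residual w)^T) i j) = (fun w =>
    (Y w *m (f w)^T *m (1%:M - projU U)) i j +
    -1 * (Y w *m (Y w)^T *m V) i j).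
  by apply/funext => w; rewrite E mxE [X in _ + X]mxE.
rewrite meanD; [|exact: Ir|by apply: integZ; exact: Ir].
rewrite meanZ; last exact: Ir.
by rewrite -!emxE !emxMr// -normal_eq mulN1r subrr.
Qed.

(** Another coefficient [B] changes the residual by [(V^T - B) *m Y], which is orthogonal to it in
    L2; the cross term drops out and a square is discarded. *)
Lemma residual_min (B : 'M[R]_(d, k)) :
  mean P (fun w => sqnorm (residual w)) <=
  mean P (fun w => sqnorm ((1%:M - projU U) *m f w - B *m Y w)).
Proof.
pose C := V^T - B.
have SCY : sqmx P (fun w => C *m Y w) by move=> i j; exact: sqmxMl.
have Sr := sqmx_residual; have Ir := integ_sqnorm Sr.
have Icr i : integ P (fun w => residual w i 0 * (C *m Y w) i 0).
  exact: sqintM.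
have cross : mean P (fun w => \sum_i residual w i 0 * (C *m Y w) i 0) = 0.
  have IrY i l : integ P (fun w => residual w i 0 * Y w l 0) by exact: sqintM.
  have rY i l : mean P (fun w => residual w i 0 * Y w l 0) = 0.
    have := congr1 (fun M : 'M[R]_(k, d) => M l i) residual_orth.
    rewrite emxE [RHS]mxE => <-; congr mean; apply/funext => w.
    by rewrite [RHS]mxE big_ord1 [(residual w)^T _ _]mxE mulrC.
  rewrite (mean_sum (index_enum _) Icr) big1// => i _.
  have -> : (fun w => residual w i 0 * (C *m Y w) i 0) =
            (fun w => \sum_l C i l * (residual w i 0 * Y w l 0)).
    apply/funext => w; rewrite [(C *m Y w) i 0]mxE mulr_sumr.
    apply: eq_bigr => l _.
    by rewrite mulrCA.
  rewrite mean_sum => [|l]; last exact: integZ.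
  by rewrite big1// => l _; rewrite meanZ// rY mulr0.
have ->: mean P (fun w => sqnorm (residual w)) =
    mean P (fun w => sqnorm (residual w) +
      2 * \sum_i residual w i 0 * (C *m Y w) i 0).
  have Ic := integ_sum (index_enum _) Icr.
  by rewrite (meanD Ir (integZ 2 Ic)) (meanZ 2 Ic) cross mulr0 addr0.
apply: le_mean.
- by apply: integD => //; apply: integZ; exact: integ_sum.
- apply: integ_sqnorm; apply: sqmxD; first by move=> i j; exact: sqmxMl.
  by apply: sqmxN => i j; exact: sqmxMl.
move=> w; have -> : (1%:M - projU U) *m f w - B *m Y w = residual w + C *m Y w.
  by rewrite /residual /C [(_ - B) *m _]mulmxBl addrA subrK.
rewrite /sqnorm mulr_sumr -big_split; apply: ler_sum => i _ /=.
rewrite !big_ord1.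
have -> : (residual w + C *m Y w) i 0 = residual w i 0 + (C *m Y w) i 0.
  by rewrite mxE.
rewrite -subr_ge0.
move: (residual w i 0) ((C *m Y w) i 0) => x y.
have -> : (x + y) ^+ 2 - (x ^+ 2 + 2 * (x * y)) = y ^+ 2 by ring.
exact: sqr_ge0.
Qed.

Hypothesis U_orth : U *m U^T = 1%:M.

Lemma residual_le : mean P (fun w => sqnorm (residual w)) <=
  mean P (fun w => sqnorm (f w)).
Proof.
apply: le_trans (residual_min 0) _; apply: le_mean.
- apply: integ_sqnorm; apply: sqmxD; first by move=> i j; exact: sqmxMl.
  by apply: sqmxN => i j; exact: sqmxMl.
- exact: integ_sqnorm.
- by move=> w; rewrite mul0mx subr0 sqnorm_projUC_le.
Qed.

(* Comparing with the projection of another drift [h] replaces the inverse of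
   the Gram matrix by the distance of [f] to [h]. *)
Lemma residual_tangent_le (h : Omega -> 'cV[R]_d) : sqmx P h ->
  mean P (fun w => sqnorm (residual w)) <=
  2 * mean P (fun w => sqnorm (f w - h w)) +
  2 * mean P (fun w => sqnorm (h w - tangent_proj P U Y h w)).
Proof.
move=> Sh.
(* The competitor is the coefficient that [tangent_proj] assigns to [h], so for [f = h] the
   comparison gives exactly the quantity in [eps2]. The inverse Gram matrix occurs as a formula only
   and is never bounded. *)
pose M := emx P (fun w => h w *m (Y w)^T) *m invmx (gram P Y).
apply: le_trans (residual_min ((1%:M - projU U) *m M)) _.
have E w : h w - tangent_proj P U Y h w =
    (1%:M - projU U) *m h w - (1%:M - projU U) *m M *m Y w.
  rewrite /tangent_proj /projY -/M -[in RHS]mulmxA.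
  move: (_ *m (M *m Y w)) => A.
  by rewrite mulmxBl mul1mx opprD addrA addrAC.
have Sht : sqmx P (fun w => h w - tangent_proj P U Y h w).
  under [X in sqmx _ X]eq_fun do rewrite E.
  apply: sqmxD; first by move=> i j; exact: sqmxMl.
  by apply: sqmxN => i j; exact: sqmxMl.
have Sfh : sqmx P (fun w => f w - h w) by apply: sqmxD => //; exact: sqmxN.
have I1 := integ_sqnorm Sfh; have I2 := integ_sqnorm Sht.
rewrite -(meanZ 2 I1) -(meanZ 2 I2) -meanD; [|exact: integZ|exact: integZ].
apply: le_mean.
- apply: integ_sqnorm; apply: sqmxD; first by move=> i j; exact: sqmxMl.
  by apply: sqmxN => i j; exact: sqmxMl.
- by apply: integD; exact: integZ.
move=> w; have -> : (1%:M - projU U) *m f w - (1%:M - projU U) *m M *m Y w =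
    (1%:M - projU U) *m (f w - h w) + (h w - tangent_proj P U Y h w).
  by rewrite E mulmxBr addrA subrK.
apply: le_trans (sqnormD _ _) _; rewrite lerD2r ler_wpM2l//.
exact: sqnorm_projUC_le.
Qed.

End residual.

(** Exhibits [U^T *m Y] as a competitor in the supremum; invertibility of the Gram matrix yields
    both the rank and the linear independence asked of it. *)
Lemma eps2_bound k d m (a : R -> 'cV[R]_d -> 'cV[R]_d)
    (b : R -> 'cV[R]_d -> 'M[R]_(d, m)) T K eps t
    (U : 'M[R]_(k, d)) (Y : Omega -> 'cV[R]_k) :
  (eps ^+ 2)%:E = eps2 P k a b T K -> 0 <= t <= T ->
  U *m U^T = 1%:M -> sqmx P Y -> gram P Y \in unitmx ->
  sqmx P (fun w => a t (U^T *m Y w)) -> sqmx P (fun w => b t (U^T *m Y w)) ->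
  ((mean P (fun w => sqnorm (U^T *m Y w)))%:E <= K)%E ->
  mean P (fun w => sqnorm (a t (U^T *m Y w) -
    tangent_proj P U Y (fun w' => a t (U^T *m Y w')) w)) <= eps ^+ 2 /\
  mean P (fun w => sqnorm ((1%:M - projU U) *m b t (U^T *m Y w))) <= eps ^+ 2.
Proof.
move=> epsE tT UU SY GY Sa Sb ZK.
pose Z w := U^T *m Y w.
pose f1 w := a t (Z w) - tangent_proj P U Y (fun w' => a t (Z w')) w.
pose f2 w := b t (Z w) - projU U *m b t (Z w).
have SZ : sqmx P Z by move=> i j; exact: sqmxMl.
have S1 : sqmx P f1.
  apply: sqmxD => //; apply: sqmxN; apply: sqmxD.
    move=> i j; apply: sqmxMl => i' j'; exact: sqmxMl.
  by move=> i j; exact: sqmxMl.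
have S2 : sqmx P f2.
  by apply: sqmxD => //; apply: sqmxN => i j; exact: sqmxMl.
have : (maxe 'E_P[fun w => (enorm (f1 w) ^+ 2)%R]
             'E_P[fun w => (frob (f2 w) ^+ 2)%R] <= (eps ^+ 2)%:E)%E.
  rewrite epsE; apply: ereal_sup_ubound.
  exists t, Z, U, Y; split=> //.
  - exact: gram_has_rank.
  - split=> //; [exact/L2_sqmx|exact: gram_lin_indep|].
    by apply: nearW.
  - under [X in 'E_P[X]%E]eq_fun do rewrite enorm_sqr.
    by rewrite expectationE//; exact: integ_sqnorm.
under [X in 'E_P[X]%E]eq_fun do rewrite enorm_sqr.
under [X in maxe _ 'E_P[X]%E]eq_fun do rewrite frob_sqr.
rewrite !expectationE; [|exact: integ_sqnorm|exact: integ_sqnorm].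
rewrite ge_max !lee_fin => /andP[H1 H2]; split=> //.
by under [X in mean P X]eq_fun do rewrite mulmxBl mul1mx.
Qed.

End second_moments.

(** * The two schemes *)

Lemma le_Ktilde {R : realType} {disp : measure_display}
    {Omega : measurableType disp} (P : probability Omega R) d T
    (X : R -> Omega -> 'cV[R]_d) N (Xn : nat -> Omega -> 'cV[R]_d) c :
  integ P (fun w => runmax (fun n => sqnorm (Xn n w)) N) ->
  c <= mean P (fun w => runmax (fun n => sqnorm (Xn n w)) N) ->
  (c%:E <= Ktilde P T X N Xn)%E.
Proof.
move=> IX cX; apply: le_ereal_inf_tmp => _ [K [_ HK] <-].
move: HK; rewrite ge_max => /andP[_]; apply: le_trans.
rewrite (_ : (fun w => _) = (fun w => runmax (fun n => sqnorm (Xn n w)) N)).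
  by rewrite expectationE// lee_fin.
by apply/funext => w; apply: eq_bigr => i _; rewrite enorm_sqr.
Qed.

Section comparison.
Context {R : realType} {disp : measure_display} {Omega : measurableType disp}.
Variables (P : probability Omega R) (F : R -> set (set Omega)) (m d : nat).
Variable W : R -> Omega -> 'cV[R]_m.
Variables (a : R -> 'cV[R]_d -> 'cV[R]_d) (b : R -> 'cV[R]_d -> 'M[R]_(d, m)).
Variables (CLip Clgb T c0 dt : R) (N : nat).
Hypotheses (ha : borel_coefficient a) (hb : borel_coefficient b).
Hypothesis ha_lip : forall s x y, 0 <= s ->
  enorm (a s x - a s y) <= CLip * enorm (x - y).
Hypothesis hb_lip : forall s x y, 0 <= s ->
  frob (b s x - b s y) <= CLip * enorm (x - y).
Hypothesis h_growth : forall s x, 0 <= s ->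
  enorm (a s x) ^+ 2 + frob (b s x) ^+ 2 <= Clgb * (1 + enorm x ^+ 2).
Hypotheses (dt_gt0 : 0 < dt) (N_gt0 : (0 < N)%N) (NdtT : N%:R * dt = T).
Hypothesis c0_ge0 : 0 <= c0.

Let t_ n : R := n%:R * dt.
Let G n := F (t_ n).
Let D := increment W dt.
Hypothesis nz : noise P G D (c0 * dt).

Let t_ge0 n : 0 <= t_ n. Proof. by rewrite mulr_ge0// ltW. Qed.

Let t_le n : (n <= N)%N -> t_ n <= T.
Proof. by move=> nN; rewrite -NdtT ler_wpM2r ?ler_nat// ltW. Qed.

Let dt_le : dt <= T.
Proof. by have := t_le N_gt0; rewrite /t_ mul1r. Qed.

Let T_ge0 : 0 <= T. Proof. exact: le_trans (ltW dt_gt0) dt_le. Qed.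

Lemma sqnorm_lip_a s x y : 0 <= s ->
  sqnorm (a s x - a s y) <= CLip ^+ 2 * sqnorm (x - y).
Proof.
move=> s0; have h := ha_lip x y s0; rewrite -!enorm_sqr -exprMn.
by rewrite lerXn2r ?nnegrE ?sqrtr_ge0// (le_trans (sqrtr_ge0 _) h).
Qed.

Lemma sqnorm_lip_b s x y : 0 <= s ->
  sqnorm (b s x - b s y) <= CLip ^+ 2 * sqnorm (x - y).
Proof.
move=> s0; have h := hb_lip x y s0; rewrite -frob_sqr -enorm_sqr -exprMn.
by rewrite lerXn2r ?nnegrE ?sqrtr_ge0// (le_trans (sqrtr_ge0 _) h).
Qed.

Lemma sqnorm_growth s x : 0 <= s ->
  sqnorm (a s x) <= Clgb * (1 + sqnorm x) /\
  sqnorm (b s x) <= Clgb * (1 + sqnorm x).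
Proof.
move=> s0; have := h_growth x s0; rewrite frob_sqr !enorm_sqr => h.
by split; apply: le_trans h; rewrite ?lerDl ?lerDr sqnorm_ge0.
Qed.

Lemma Clgb_ge0 : 0 <= Clgb.
Proof.
have [h _] := sqnorm_growth 0 (lexx 0).
have := le_trans (sqnorm_ge0 _) h; rewrite pmulr_lge0//.
by rewrite ltr_pwDl// sqnorm_ge0.
Qed.

(** The width [p] is free so that one statement covers [a] ([p = 1]) and [b] ([p = m]). *)
Lemma coefficient_sqmx p (f : R -> 'cV[R]_d -> 'M[R]_(d, p)) n t X :
  borel_coefficient f -> 0 <= t ->
  (forall x, sqnorm (f t x) <= Clgb * (1 + sqnorm x)) ->
  adapted_mx (G n) X -> sqmx P X ->
  [/\ adapted_mx (G n) (fun w => f t (X w)), sqmx P (fun w => f t (X w)) &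
      mean P (fun w => sqnorm (f t (X w))) <=
        Clgb * (1 + mean P (fun w => sqnorm (X w)))].
Proof.
move=> mf t0 grow aX SX; have afX := adapted_mx_coefficient mf t0 aX.
have IX := integ_sqnorm SX.
have IB : integ P (fun w => Clgb * (1 + sqnorm (X w))).
  by apply: integZ; apply: integD => //; exact: integ_cst.
have SfX : sqmx P (fun w => f t (X w)).
  by apply: sqmx_dom IB => // i j; exact: (noise_measurable nz).
split=> //.
have I1 := integ_cst P 1.
rewrite -[X in _ * (X + _)](mean_cst P 1) -(meanD I1 IX) -(meanZ _ (integD I1 IX)).
by apply: le_mean => //; exact: integ_sqnorm.
Qed.

Let coef_a n t X := @coefficient_sqmx 1 a n t X ha.
Let coef_b n t X := @coefficient_sqmx m b n t X hb.

Lemma noise_mulmx n p (H : Omega -> 'M[R]_(p, m)) :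
  adapted_mx (G n) H -> sqmx P H ->
  [/\ adapted_mx (G n.+1) (fun w => H w *m D n w),
      sqmx P (fun w => H w *m D n w) &
      mean P (fun w => sqnorm (H w *m D n w)) <=
        m%:R * (c0 * dt) * mean P (fun w => sqnorm (H w))].
Proof.
move=> aH SH.
have S i j := noise_sqint nz j (aH i j) (SH i j).
have SHD : sqmx P (fun w => H w *m D n w).
  move=> i j; under [X in sqint _ X]eq_fun do rewrite mxE.
  by apply: sqint_sum => l; rewrite (ord1 j); have [] := S i l.
split=> //.
  apply: adapted_mxM; last exact: (noise_adapted nz).
  by move=> i j; apply: (noise_adaptedS nz (leqnSn n)); exact: aH.
have IH i j : integ P (fun w => H w i j ^+ 2) by have [] := SH i j.
have IHD i j : integ P (fun w => (H w i j * D n w j 0) ^+ 2) by have [[]] := S i j.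
have ID i := integ_sum (index_enum _) (IHD i).
apply: (@le_trans _ _ (mean P (fun w =>
    m%:R * \sum_i \sum_j (H w i j * D n w j 0) ^+ 2))).
  apply: le_mean; first exact: integ_sqnorm.
    by apply: integZ; exact: integ_sum.
  move=> w; rewrite mulr_sumr; apply: ler_sum => i _.
  by rewrite big_ord1 mxE sqr_sum_le.
rewrite (meanZ _ (integ_sum (index_enum _) ID)) -mulrA ler_wpM2l//.
rewrite (mean_sum (index_enum _) ID).
rewrite (mean_sum (index_enum _) (fun i => integ_sum (index_enum _) (IH i))).
rewrite mulr_sumr; apply: ler_sum => i _.
rewrite (mean_sum (index_enum _) (IHD i)) (mean_sum (index_enum _) (IH i)).
by rewrite mulr_sumr; apply: ler_sum => j _; have [] := S i j.
Qed.

(** * Moments of Euler-Maruyama *)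

Section euler.
Variable X0 : Omega -> 'cV[R]_d.
Hypotheses (aX0 : adapted_mx (G 0) X0) (SX0 : sqmx P X0).

Let X := euler_maruyama W a b dt X0.

Lemma euler_adapted n : adapted_mx (G n) (X n) /\ sqmx P (X n).
Proof.
elim: n => [//|n [aX SX]].
have [aa Sa _] := coef_a (t_ge0 n) (fun x => (sqnorm_growth x (t_ge0 n)).1) aX SX.
have [ab Sb _] := coef_b (t_ge0 n) (fun x => (sqnorm_growth x (t_ge0 n)).2) aX SX.
have [abD SbD _] := noise_mulmx ab Sb.
split; last by apply: sqmxD => //; apply: sqmxD => //; exact: sqmxZ.
apply: adapted_mxD => //; apply: adapted_mxD.
  by move=> i j; apply: (noise_adaptedS nz (leqnSn n)); exact: aX.
by apply: adapted_mxZ => i j; apply: (noise_adaptedS nz (leqnSn n)); exact: aa.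
Qed.

(** The two coefficients of [process_max_bound] per unit of time, using 3 N dt^2 = 3 T dt, times the
    growth constant. *)
Definition growth_rate : R := (3 * T + 12 * m%:R * c0) * Clgb.

Lemma growth_rate_ge0 : 0 <= growth_rate.
Proof. by rewrite mulr_ge0 ?Clgb_ge0// addr_ge0// !mulr_ge0. Qed.

(** The Gronwall bound; neither [N] nor [dt] enters, so it may be part of the final constant. *)
Definition euler_moment : R :=
  (3 * mean P (fun w => sqnorm (X0 w)) + growth_rate * T)
  * expR (growth_rate * T).

Lemma euler_moment_le n : (n <= N)%N ->
  mean P (fun w => sqnorm (X n w)) <= euler_moment.
Proof.
move=> nN; pose v n := mean P (fun w => sqnorm (X n w)).
have v_ge0 i : 0 <= v i by apply: mean_ge0 => w; exact: sqnorm_ge0.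
have A0 := growth_rate_ge0.
have M0 : 0 <= 3 * v 0%N + growth_rate * T by rewrite addr_ge0// mulr_ge0.
have aS i := coef_a (t_ge0 i) (fun x => (sqnorm_growth x (t_ge0 i)).1)
  (euler_adapted i).1 (euler_adapted i).2.
have bS i := coef_b (t_ge0 i) (fun x => (sqnorm_growth x (t_ge0 i)).2)
  (euler_adapted i).1 (euler_adapted i).2.
have step j : (j <= N)%N ->
    v j <= (3 * v 0%N + growth_rate * T) + (growth_rate * dt) * \sum_(i < j) v i.
  move=> jN.
  have [Imax bound] := process_max_bound nz (N := N) (dt := dt) (Z := X)
    (g := fun i w => a (t_ i) (X i w)) (H := fun i w => b (t_ i) (X i w))
    (fun i w _ => erefl) SX0 (fun i _ => let: And3 _ q _ := aS i in q)
    (fun i _ => let: And3 q _ _ := bS i in q)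
    (fun i _ => let: And3 _ q _ := bS i in q) jN.
  have le1 : v j <= mean P (fun w => runmax (fun i => sqnorm (X i w)) j).
    apply: le_mean => // [|w]; first by apply: integ_sqnorm; have [] := euler_adapted j.
    exact: (le_runmax (fun i => sqnorm (X i w))).
  apply: le_trans le1 _; apply: le_trans bound _; rewrite -/(v 0%N).
  have sum_le (u : nat -> R) : (forall i, u i <= Clgb * (1 + v i)) ->
      \sum_(i < j) u i <= Clgb * (j%:R + \sum_(i < j) v i).
    move=> uv; rewrite -[j in X in _ * (X + _)]card_ord -sumr_const -big_split.
    by rewrite mulr_sumr; apply: ler_sum.
  have sa := sum_le (fun i => mean P (fun w => sqnorm (a (t_ i) (X i w))))
    (fun i => let: And3 _ _ q := aS i in q).
  have sb := sum_le (fun i => mean P (fun w => sqnorm (b (t_ i) (X i w))))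
    (fun i => let: And3 _ _ q := bS i in q).
  have c1 : 0 <= 3 * N%:R * dt ^+ 2 by rewrite mulr_ge0 ?sqr_ge0// mulr_ge0.
  have c2 : 0 <= 12 * m%:R * (c0 * dt) by rewrite !mulr_ge0// ltW.
  apply: le_trans (lerD (lerD (lexx _) (ler_wpM2l c1 sa)) (ler_wpM2l c2 sb)) _.
  rewrite -/(v 0%N); set s := \sum_(i < j) v i.
  have -> : 3 * v 0%N + 3 * N%:R * dt ^+ 2 * (Clgb * (j%:R + s)) +
      12 * m%:R * (c0 * dt) * (Clgb * (j%:R + s)) =
      3 * v 0%N + growth_rate * (j%:R * dt) + growth_rate * dt * s.
    by rewrite /growth_rate -NdtT; ring.
  by rewrite lerD2r lerD2l ler_wpM2l// t_le.
have Adt0 : 0 <= growth_rate * dt by rewrite mulr_ge0// ltW.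
apply: le_trans (discrete_gronwall Adt0 M0 step nN) _.
rewrite ler_wpM2l// ler_expR -mulrA ler_wpM2l// mulrC; exact: t_le.
Qed.

End euler.

(** * The splitting scheme and its one-step defect *)

Section scheme.
Variables (k : nat) (U0 : 'M[R]_(k, d)) (Y0 : Omega -> 'cV[R]_k).
Variables (Un : nat -> 'M[R]_(k, d)) (Yn : nat -> Omega -> 'cV[R]_k).
Hypotheses (U0_orth : U0 *m U0^T = 1%:M).
Hypotheses (aY0 : adapted_mx (G 0) Y0) (SY0 : sqmx P Y0).
Hypothesis scheme : DLR_PS_scheme P W a b dt N U0 Y0 Un Yn.

Let X n w := (Un n)^T *m Yn n w.
Let aX n w := a (t_ n) (X n w).
Let bX n w := b (t_ n) (X n w).
Let Yt n w := Yn n w + dt *: (Un n *m aX n w) + Un n *m bX n w *m D n w.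

(** The QR factors cancel in the product: U_{n+1}^T Y_{n+1} = U_{n+1}^T R Yt = Ut^T Yt. The witness
    [V] is the increment quotient of [U_n], which solves the normal equation of the residual
    section. *)
Lemma scheme_spec n : (n < N)%N -> exists (V : 'M[R]_(k, d)) (Rn : 'M[R]_k),
  [/\ gram P (Yt n) *m V =
        emx P (fun w => Yt n w *m (aX n w)^T) *m (1%:M - projU (Un n)),
      forall w, X n.+1 w = (Un n)^T *m Yt n w + dt *: (V^T *m Yt n w),
      Un n.+1 *m (Un n.+1)^T = 1%:M &
      forall w, Yn n.+1 w = Rn *m Yt n w].
Proof.
have [_ _ step] := scheme; move=> nN.
have [Ut [Rn [[UtE _] UtR UU _ YE]]] := step n nN.
exists (dt^-1 *: (Ut - Un n)), Rn; split=> //.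
  rewrite -scalemxAr mulmxBr UtE addrAC subrr add0r scalerA mulVf ?scale1r//.
  by rewrite gt_eqF.
move=> w; rewrite /X YE mulmxA -UtR [(dt^-1 *: _)^T]linearZ /= -scalemxAl.
rewrite scalerA divff ?gt_eqF// scale1r [(_ - _)^T]linearB /= mulmxBl.
by rewrite [RHS]addrC subrK.
Qed.

(** [U_n] is a contraction, so the drift contributes order dt^2 <= T dt and the noise order dt. This
    mean-square displacement is what the Lipschitz comparison of drifts costs. *)
Lemma predictor_adapted n : Un n *m (Un n)^T = 1%:M ->
  adapted_mx (G n) (Yn n) -> sqmx P (Yn n) ->
  [/\ adapted_mx (G n.+1) (Yt n), sqmx P (Yt n) &
      mean P (fun w => sqnorm (Yt n w - Yn n w)) <=
        2 * dt * (T + m%:R * c0) *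
        (Clgb * (1 + mean P (fun w => sqnorm (X n w))))].
Proof.
move=> UU aY SY.
have aXn : adapted_mx (G n) (X n).
  by apply: adapted_mxM => //; exact: adapted_mx_cst.
have SXn : sqmx P (X n) by move=> i j; exact: sqmxMl.
have [aa Sa Ea] := coef_a (t_ge0 n) (fun x => (sqnorm_growth x (t_ge0 n)).1) aXn SXn.
have [ab Sb Eb] := coef_b (t_ge0 n) (fun x => (sqnorm_growth x (t_ge0 n)).2) aXn SXn.
have aUb : adapted_mx (G n) (fun w => Un n *m bX n w).
  by apply: adapted_mxM => //; exact: adapted_mx_cst.
have SUa : sqmx P (fun w => Un n *m aX n w) by move=> i j; exact: sqmxMl.
have SUb : sqmx P (fun w => Un n *m bX n w) by move=> i j; exact: sqmxMl.
have [aUbD SUbD EUbD] := noise_mulmx aUb SUb.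
have up p (f : Omega -> 'M[R]_(k, p)) : adapted_mx (G n) f -> adapted_mx (G n.+1) f.
  by move=> af i j; apply: (noise_adaptedS nz (leqnSn n)); exact: af.
split.
- apply: adapted_mxD => //; apply: adapted_mxD; first exact: up.
  by apply: up; apply: adapted_mxZ; apply: adapted_mxM => //; exact: adapted_mx_cst.
- by apply: sqmxD => //; apply: sqmxD => //; exact: sqmxZ.
have SdUa := sqmxZ dt SUa.
have I1 := integ_sqnorm SdUa; have I2 := integ_sqnorm SUbD.
have IUa := integ_sqnorm SUa.
apply: (@le_trans _ _ (2 * mean P (fun w => sqnorm (dt *: (Un n *m aX n w))) +
    2 * mean P (fun w => sqnorm (Un n *m bX n w *m D n w)))).
  rewrite -(meanZ 2 I1) -(meanZ 2 I2) -(meanD (integZ 2 I1) (integZ 2 I2)).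
  have E : (fun w => sqnorm (Yt n w - Yn n w)) = (fun w =>
      sqnorm (dt *: (Un n *m aX n w) + Un n *m bX n w *m D n w)).
    apply/funext => w; congr sqnorm.
    by rewrite /Yt -(addrA (Yn n w)) [LHS]addrC addKr.
  rewrite E; apply: le_mean.
  - by apply: integ_sqnorm; exact: sqmxD.
  - by apply: integD; exact: integZ.
  - by move=> w; exact: sqnormD.
have le_Ua : mean P (fun w => sqnorm (dt *: (Un n *m aX n w))) <=
    dt ^+ 2 * (Clgb * (1 + mean P (fun w => sqnorm (X n w)))).
  under [X in mean P X]eq_fun do rewrite sqnormZ.
  rewrite (meanZ _ IUa) ler_wpM2l ?sqr_ge0//; apply: le_trans Ea.
  apply: le_mean => // [|w]; first exact: integ_sqnorm.
  exact: sqnorm_U_le.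
have le_Ub : mean P (fun w => sqnorm (Un n *m bX n w *m D n w)) <=
    m%:R * (c0 * dt) * (Clgb * (1 + mean P (fun w => sqnorm (X n w)))).
  apply: le_trans EUbD _; rewrite ler_wpM2l//.
    by rewrite !mulr_ge0// ltW.
  apply: le_trans Eb; apply: le_mean => [||w]; [exact: integ_sqnorm..|].
  exact: sqnorm_U_le.
have x0 : 0 <= Clgb * (1 + mean P (fun w => sqnorm (X n w))).
  rewrite mulr_ge0 ?Clgb_ge0// addr_ge0//.
  by apply: mean_ge0 => w; exact: sqnorm_ge0.
apply: le_trans (lerD (ler_wpM2l (ler0n R 2) le_Ua) (ler_wpM2l (ler0n R 2) le_Ub)) _.
move: (Clgb * _) x0 => x x0.
have -> : 2 * (dt ^+ 2 * x) + 2 * (m%:R * (c0 * dt) * x) =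
    2 * dt * x * (dt + m%:R * c0) by ring.
have -> : 2 * dt * (T + m%:R * c0) * x = 2 * dt * x * (T + m%:R * c0) by ring.
by rewrite ler_wpM2l ?lerD2r// !mulr_ge0// ltW.
Qed.

Lemma scheme_adapted n : (n <= N)%N ->
  [/\ Un n *m (Un n)^T = 1%:M, adapted_mx (G n) (Yn n) & sqmx P (Yn n)].
Proof.
elim: n => [_|n IH nN]; first by have [-> -> _] := scheme.
have [UU aY SY] := IH (ltnW nN); have [aYt SYt _] := predictor_adapted UU aY SY.
have [V [Rn [_ _ UU' YE]]] := scheme_spec nN; split=> //.
- have -> : Yn n.+1 = fun w => Rn *m Yt n w by exact/funext.
  by apply: adapted_mxM => //; exact: adapted_mx_cst.
- have -> : Yn n.+1 = fun w => Rn *m Yt n w by exact/funext.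
  by move=> i j; exact: sqmxMl.
Qed.

Lemma lowrank_adapted n : (n <= N)%N -> adapted_mx (G n) (X n) /\ sqmx P (X n).
Proof.
move=> /scheme_adapted[_ aY SY]; split; last by move=> i j; exact: sqmxMl.
by apply: adapted_mxM => //; exact: adapted_mx_cst.
Qed.

Variables (eps : R) (K : \bar R).
Hypothesis eps_def : (eps ^+ 2)%:E = eps2 P k a b T K.
Hypothesis moment_le : forall n, (n <= N)%N ->
  ((mean P (fun w => sqnorm (X n w)))%:E <= K)%E.
Hypothesis gram_inv : forall n, (n < N)%N -> gram P (Yn n) \in unitmx.

Let x_ n := 1 + mean P (fun w => sqnorm (X n w)).

Let x_ge0 n : 0 <= x_ n.
Proof. by rewrite addr_ge0//; apply: mean_ge0 => w; exact: sqnorm_ge0. Qed.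

(** The diffusion is projected by [U_n] alone, so X_n itself is a suitable competitor in [eps]. *)
Lemma diffusion_error n : (n < N)%N ->
  mean P (fun w => sqnorm ((1%:M - projU (Un n)) *m bX n w)) <= eps ^+ 2.
Proof.
move=> nN; have [UU aY SY] := scheme_adapted (ltnW nN).
have [aXn SXn] := lowrank_adapted (ltnW nN).
have tT : 0 <= t_ n <= T by rewrite t_ge0 t_le// ltnW.
have [_ Sa _] := coef_a (t_ge0 n) (fun x => (sqnorm_growth x (t_ge0 n)).1) aXn SXn.
have [_ Sb _] := coef_b (t_ge0 n) (fun x => (sqnorm_growth x (t_ge0 n)).2) aXn SXn.
by have [] := eps2_bound eps_def tT UU SY (gram_inv nN) Sa Sb (moment_le (ltnW nN)).
Qed.

(* The [r_n] of the header, defined without reference to the choice of [Ut]. *)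
Definition drift_defect n w : 'cV[R]_d :=
  dt^-1 *: (X n w + dt *: aX n w + projU (Un n) *m bX n w *m D n w - X n.+1 w).

(** The 4 is the 2 of [residual_tangent_le] times the 2 of [predictor_adapted]; the Lipschitz
    constant turns the displacement into a drift error. *)
Definition defect_rate : R := 4 * CLip ^+ 2 * (T + m%:R * c0) * Clgb.

(* Except at the last step, [U_n^T Yt] is again of rank [k] with second moment
   at most that of [X_{n+1}], hence admissible in the definition of [eps]: this
   is what makes the bound independent of [gamma]. *)
Lemma drift_defect_le n : (n < N)%N ->
  sqmx P (drift_defect n) /\
  mean P (fun w => sqnorm (drift_defect n w)) <= 2 * eps ^+ 2 +
    (defect_rate * dt + (n.+1 == N)%:R * Clgb) * x_ n.
Proof.
move=> nN; have [UU aY SY] := scheme_adapted (ltnW nN).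
have [aXn SXn] := lowrank_adapted (ltnW nN).
have [aYt SYt EYt] := predictor_adapted UU aY SY.
have tT : 0 <= t_ n <= T by rewrite t_ge0 t_le// ltnW.
have grow x := sqnorm_growth x (t_ge0 n).
have [_ Sa Ea] := coef_a (t_ge0 n) (fun x => (grow x).1) aXn SXn.
have [V [Rn [VE XE _ YE]]] := scheme_spec nN.
have rE : drift_defect n = residual (Un n) (Yt n) (aX n) V.
  apply/funext => w; rewrite /drift_defect /residual XE.
  have -> : (Un n)^T *m Yt n w = X n w + dt *: (projU (Un n) *m aX n w) +
      projU (Un n) *m bX n w *m D n w.
    by rewrite /Yt !mulmxDr -scalemxAr /projU !mulmxA.
  move: (_ *m D n w) (X n w) => p q.
  have -> : q + dt *: aX n w + p - (q + dt *: (projU (Un n) *m aX n w) + p +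
      dt *: (V^T *m Yt n w)) =
      dt *: (aX n w - projU (Un n) *m aX n w - V^T *m Yt n w).
    rewrite !scalerBr; apply/matrixP => i j; rewrite !mxE; ring.
  by rewrite scalerA mulVf ?gt_eqF// scale1r mulmxBl mul1mx.
rewrite rE; split; first exact: sqmx_residual.
have e0 : 0 <= 2 * eps ^+ 2 by rewrite mulr_ge0// sqr_ge0.
have q0 : 0 <= defect_rate.
  have L0 : 0 <= 4 * CLip ^+ 2 by rewrite mulr_ge0 ?sqr_ge0.
  by rewrite mulr_ge0 ?Clgb_ge0// mulr_ge0// addr_ge0// mulr_ge0.
case: eqP => [_|nN'].
  (* Last step: a bound of order one, charged to the term with [Clgb]. *)
  apply: le_trans (residual_le SYt Sa VE UU) _; apply: le_trans Ea _.
  have -> : 2 * eps ^+ 2 + (defect_rate * dt + true%:R * Clgb) * x_ n =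
      2 * eps ^+ 2 + defect_rate * dt * x_ n + Clgb * x_ n by rewrite /=; ring.
  by rewrite lerDr addr_ge0// mulr_ge0// mulr_ge0// ltW.
rewrite mul0r addr0.
have n1N : (n.+1 < N)%N by rewrite ltn_neqAle nN andbT; exact/eqP.
(* The Gram matrix of Y_{n+1} is R gram(Yt) R^T, so its invertibility forces that of its middle
   factor. *)
have GYt : gram P (Yt n) \in unitmx.
  have := gram_inv n1N; rewrite (_ : Yn n.+1 = fun w => Rn *m Yt n w); last exact/funext.
  by rewrite gramM// !unitmx_mul => /andP[/andP[_]].
(* The right-hand side of the normal equation ends with I - P_U, which kills U_n^T; an invertible
   Gram matrix passes this on to [V]. *)
have UV : Un n *m V^T = 0.
  rewrite -[LHS]trmxK trmx_mul trmxK -[V](mulKmx GYt) VE.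
  rewrite -!mulmxA mulmxBl mul1mx /projU -mulmxA UU mulmx1 subrr !mulmx0.
  exact: trmx0.
have UYtE w : (Un n)^T *m Yt n w = projU (Un n) *m X n.+1 w.
  rewrite XE mulmxDr -scalemxAr /projU mulmxA -(mulmxA (Un n)^T (Un n)) UU mulmx1.
  by rewrite -!mulmxA (mulmxA (Un n)) UV mul0mx mulmx0 scaler0 addr0.
pose Z w := (Un n)^T *m Yt n w.
have aZ : adapted_mx (G n.+1) Z.
  by apply: adapted_mxM => //; exact: adapted_mx_cst.
have SZ : sqmx P Z by move=> i j; exact: sqmxMl.
have [_ SaZ _] := coef_a (t_ge0 n) (fun x => (grow x).1) aZ SZ.
have [_ SbZ _] := coef_b (t_ge0 n) (fun x => (grow x).2) aZ SZ.
have ZK : ((mean P (fun w => sqnorm (Z w)))%:E <= K)%E.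
  apply: le_trans (moment_le nN); rewrite lee_fin; apply: le_mean.
  - exact: integ_sqnorm.
  - by apply: integ_sqnorm; have [] := lowrank_adapted nN.
  - by move=> w; rewrite /Z UYtE sqnorm_projU_le.
have [Etan _] := eps2_bound eps_def tT UU SYt GYt SaZ SbZ ZK.
apply: le_trans (residual_tangent_le SYt Sa VE UU SaZ) _.
rewrite addrC lerD// ?ler_wpM2l//.
have SYY : sqmx P (fun w => Yt n w - Yn n w) by apply: sqmxD => //; exact: sqmxN.
have IYY := integ_sqnorm SYY.
have le1 : mean P (fun w => sqnorm (aX n w - a (t_ n) (Z w))) <=
    CLip ^+ 2 * mean P (fun w => sqnorm (Yt n w - Yn n w)).
  rewrite -(meanZ _ IYY); apply: le_mean.
  - by apply: integ_sqnorm; apply: sqmxD => //; exact: sqmxN.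
  - exact: integZ.
  move=> w; apply: le_trans (sqnorm_lip_a _ _ (t_ge0 n)) _.
  rewrite ler_wpM2l ?sqr_ge0//.
  (* U_n^T is an isometry, so the distance of the two arguments is the displacement of the
     predictor. *)
  by rewrite /Z /X -mulmxBr sqnorm_trU// -sqnormN opprB.
apply: le_trans (ler_wpM2l (ler0n R 2) le1) _.
apply: le_trans (ler_wpM2l (ler0n R 2) (ler_wpM2l (sqr_ge0 CLip) EYt)) _.
rewrite -/(x_ n) le_eqVlt; apply/orP; left; apply/eqP.
by rewrite /defect_rate; ring.
Qed.

(** * The error recursion *)

Variable X0 : Omega -> 'cV[R]_d.
Hypotheses (aX0 : adapted_mx (G 0) X0) (SX0 : sqmx P X0).

Let XE := euler_maruyama W a b dt X0.
Let e n w := XE n w - X n w.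
Let g n w := a (t_ n) (XE n w) - aX n w + drift_defect n w.
Let H n w := b (t_ n) (XE n w) - projU (Un n) *m bX n w.
Let delta n := mean P (fun w => sqnorm (e n w)).

Lemma error_step n w : e n.+1 w = e n w + dt *: g n w + H n w *m D n w.
Proof.
have XS : X n.+1 w = X n w + dt *: aX n w + projU (Un n) *m bX n w *m D n w
    - dt *: drift_defect n w.
  by rewrite /drift_defect scalerA divff ?gt_eqF// scale1r subKr.
rewrite /e XS /XE /= /g /H -/(t_ n) -/(D n w) mulmxBl scalerDr scalerBr.
move: (_ *m D n w) (_ *m D n w) (dt *: _) (dt *: _) (dt *: _) => p q x y z.
by apply/matrixP => i j; rewrite !mxE; ring.
Qed.

Let delta_ge0 n : 0 <= delta n.
Proof. by apply: mean_ge0 => w; exact: sqnorm_ge0. Qed.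

Lemma error_sqmx n : (n <= N)%N -> sqmx P (e n).
Proof.
move=> nN; apply: sqmxD; first by have [] := euler_adapted aX0 SX0 n.
by apply: sqmxN; have [] := lowrank_adapted nN.
Qed.

(** An a priori bound would involve Y_0, on which the constant may not depend. Writing X_n as
    Euler-Maruyama minus the error gives a uniform bound plus a term that Gronwall absorbs. *)
Lemma lowrank_moment n : (n <= N)%N ->
  x_ n <= 1 + 2 * euler_moment X0 + 2 * delta n.
Proof.
move=> nN; rewrite /x_ -addrA lerD2l.
have [_ SE] := euler_adapted aX0 SX0 n; have Se := error_sqmx nN.
have IE := integ_sqnorm SE; have Ie := integ_sqnorm Se.
have le1 := euler_moment_le aX0 SX0 nN.
apply: le_trans (lerD (ler_wpM2l (ler0n R 2) le1) (lexx _)).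
rewrite -(meanZ 2 IE) -(meanZ 2 Ie) -(meanD (integZ 2 IE) (integZ 2 Ie)).
apply: le_mean.
- by apply: integ_sqnorm; have [] := lowrank_adapted nN.
- by apply: integD; exact: integZ.
- move=> w; have -> : X n w = XE n w - e n w by rewrite subKr.
  by apply: le_trans (sqnormD _ _) _; rewrite sqnormN.
Qed.

Lemma mean_sqnormD_le p (f h : Omega -> 'M[R]_(d, p)) :
  sqmx P f -> sqmx P h ->
  mean P (fun w => sqnorm (f w + h w)) <=
  2 * mean P (fun w => sqnorm (f w)) + 2 * mean P (fun w => sqnorm (h w)).
Proof.
move=> Sf Sh; have If := integ_sqnorm Sf; have Ih := integ_sqnorm Sh.
rewrite -(meanZ 2 If) -(meanZ 2 Ih) -(meanD (integZ 2 If) (integZ 2 Ih)).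
apply: le_mean => [||w]; last exact: sqnormD.
  by apply: integ_sqnorm; exact: sqmxD.
by apply: integD; exact: integZ.
Qed.

Lemma drift_error n : (n < N)%N ->
  sqmx P (g n) /\
  mean P (fun w => sqnorm (g n w)) <= 2 * (CLip ^+ 2 * delta n) +
    2 * (2 * eps ^+ 2 + (defect_rate * dt + (n.+1 == N)%:R * Clgb) * x_ n).
Proof.
move=> nN; have [aE SE] := euler_adapted aX0 SX0 n.
have [aXn SXn] := lowrank_adapted (ltnW nN).
have grow x := sqnorm_growth x (t_ge0 n).
have [_ SaE _] := coef_a (t_ge0 n) (fun x => (grow x).1) aE SE.
have [_ Sa _] := coef_a (t_ge0 n) (fun x => (grow x).1) aXn SXn.
have [Sr Er] := drift_defect_le nN.
have Sd : sqmx P (fun w => a (t_ n) (XE n w) - aX n w).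
  by apply: sqmxD => //; exact: sqmxN.
split; first exact: sqmxD.
apply: le_trans (mean_sqnormD_le Sd Sr) _; rewrite lerD ?ler_wpM2l//.
have Ie := integ_sqnorm (error_sqmx (ltnW nN)).
rewrite -(meanZ _ Ie); apply: le_mean; [exact: integ_sqnorm|exact: integZ|].
by move=> w; exact: sqnorm_lip_a.
Qed.

Lemma noise_error n : (n < N)%N ->
  [/\ adapted_mx (G n) (H n), sqmx P (H n) &
  mean P (fun w => sqnorm (H n w)) <=
    2 * (CLip ^+ 2 * delta n) + 2 * eps ^+ 2].
Proof.
move=> nN; have [aE SE] := euler_adapted aX0 SX0 n.
have [aXn SXn] := lowrank_adapted (ltnW nN).
have grow x := sqnorm_growth x (t_ge0 n).
have [abE SbE _] := coef_b (t_ge0 n) (fun x => (grow x).2) aE SE.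
have [ab Sb _] := coef_b (t_ge0 n) (fun x => (grow x).2) aXn SXn.
have SPb : sqmx P (fun w => projU (Un n) *m bX n w) by move=> i j; exact: sqmxMl.
have Sd : sqmx P (fun w => b (t_ n) (XE n w) - bX n w).
  by apply: sqmxD => //; exact: sqmxN.
have Sc : sqmx P (fun w => (1%:M - projU (Un n)) *m bX n w).
  by move=> i j; exact: sqmxMl.
split.
- apply: adapted_mxD => //.
  under [X in adapted_mx _ X]eq_fun do rewrite -scaleN1r.
  by apply: adapted_mxZ; apply: adapted_mxM => //; exact: adapted_mx_cst.
- by apply: sqmxD => //; exact: sqmxN.
have HE w : H n w = b (t_ n) (XE n w) - bX n w + (1%:M - projU (Un n)) *m bX n w.
  by rewrite /H mulmxBl mul1mx addrA subrK.
under [X in mean P X]eq_fun do rewrite HE.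
apply: le_trans (mean_sqnormD_le Sd Sc) _.
rewrite lerD ?ler_wpM2l//; last exact: diffusion_error.
have Ie := integ_sqnorm (error_sqmx (ltnW nN)).
rewrite -(meanZ _ Ie); apply: le_mean; [exact: integ_sqnorm|exact: integZ|].
by move=> w; exact: sqnorm_lip_b.
Qed.

(** Everything that multiplies the error: 3 T and 12 m c0 from [process_max_bound], times 2 for each
    splitting of [g] and [H]; the middle term is the feedback through [lowrank_moment], hence
    another 2. *)
Definition error_rate : R := 6 * T * CLip ^+ 2
  + 12 * T * (defect_rate * T + Clgb) + 24 * m%:R * c0 * CLip ^+ 2.

Definition error_eps : R := (12 * T + 24 * m%:R * c0) * T.

Definition error_dt : R :=
  6 * T * (1 + 2 * euler_moment X0) * (defect_rate * T + Clgb).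

Definition error_const : R :=
  (3 + error_eps + error_dt) * expR (error_rate * T).

Let defect_rate_ge0 : 0 <= defect_rate.
Proof.
have L0 : 0 <= 4 * CLip ^+ 2 by rewrite mulr_ge0 ?sqr_ge0.
by rewrite mulr_ge0 ?Clgb_ge0// mulr_ge0// addr_ge0// mulr_ge0.
Qed.

Let rate_ge0 : 0 <= defect_rate * T + Clgb.
Proof. by rewrite addr_ge0 ?Clgb_ge0// mulr_ge0. Qed.

Let euler_moment_ge0 : 0 <= euler_moment X0.
Proof.
rewrite mulr_ge0 ?expR_ge0// addr_ge0//; last first.
  by rewrite mulr_ge0// growth_rate_ge0.
by rewrite mulr_ge0// mean_ge0// => w; exact: sqnorm_ge0.
Qed.

Lemma error_rate_ge0 : 0 <= error_rate.
Proof.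
have L0 := sqr_ge0 CLip; have r0 := rate_ge0.
rewrite /error_rate; move: (CLip ^+ 2) (defect_rate * T + Clgb) L0 r0 => L r L0 r0.
by rewrite !addr_ge0// !mulr_ge0.
Qed.

Lemma error_eps_ge0 : 0 <= error_eps.
Proof. by rewrite mulr_ge0// addr_ge0// !mulr_ge0. Qed.

Lemma error_dt_ge0 : 0 <= error_dt.
Proof. by rewrite mulr_ge0// !mulr_ge0// addr_ge0// mulr_ge0. Qed.

(** The defect of order one is thus counted at most once along the whole partition. *)
Lemma sum_last_step n : (n <= N)%N ->
  \sum_(i < n) (i.+1 == N)%:R = (n == N)%:R :> R.
Proof.
elim: n => [_|n IH nN]; first by rewrite big_ord0 eq_sym gtn_eqF.
by rewrite big_ord_recr /= IH ?(ltnW nN)// (ltn_eqF nN) add0r.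
Qed.

(** Gronwall is applied to the mean of the running maximum, which dominates each [delta i] and so
    closes the recursion. The bound is for squares: [dt] here becomes the order 1/2 of the
    theorem. *)
Lemma lowrank_error :
  integ P (fun w => runmax (fun n => sqnorm (e n w)) N) /\
  mean P (fun w => runmax (fun n => sqnorm (e n w)) N) <=
    error_const * (delta 0 + dt + eps ^+ 2).
Proof.
pose v n := mean P (fun w => runmax (fun n => sqnorm (e n w)) n).
pose xb := 1 + 2 * euler_moment X0.
have xb0 : 0 <= xb by rewrite addr_ge0// mulr_ge0.
have bound n (nN : (n <= N)%N) := process_max_bound nz (N := N) (dt := dt) (Z := e)
  (g := g) (H := H) (fun i w _ => error_step i w) (error_sqmx (leq0n N))
  (fun i iN => (drift_error iN).1)
  (fun i iN => let: And3 q _ _ := noise_error iN in q)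
  (fun i iN => let: And3 _ q _ := noise_error iN in q) nN.
split; first by have [] := bound N (leqnn N).
have delta_v n : (n <= N)%N -> delta n <= v n.
  move=> nN; apply: le_mean; first exact: integ_sqnorm (error_sqmx nN).
    by have [] := bound n nN.
  by move=> w; exact: (le_runmax (fun n => sqnorm (e n w))).
pose B := 3 * delta 0 + error_eps * eps ^+ 2 + error_dt * dt.
have eps20 := sqr_ge0 eps.
have B0 : 0 <= B.
  have d0 := delta_ge0 0.
  apply: addr_ge0 (mulr_ge0 error_dt_ge0 (ltW dt_gt0)).
  by apply: addr_ge0 (mulr_ge0 error_eps_ge0 eps20); rewrite mulr_ge0.
have step n : (n <= N)%N -> v n <= B + error_rate * dt * \sum_(i < n) v i.
  move=> nN; apply: le_trans (bound n nN).2 _.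
  have iN (i : 'I_n) : (i < N)%N by exact: leq_trans (ltn_ord i) nN.
  have c1 : 0 <= 3 * N%:R * dt ^+ 2 by rewrite mulr_ge0 ?sqr_ge0// mulr_ge0.
  have c2 : 0 <= 12 * m%:R * (c0 * dt) by rewrite !mulr_ge0// ltW.
  have per_step (i : 'I_n) :
      3 * N%:R * dt ^+ 2 * mean P (fun w => sqnorm (g i w)) +
      12 * m%:R * (c0 * dt) * mean P (fun w => sqnorm (H i w)) <=
      error_rate * dt * v i + (12 * T + 24 * m%:R * c0) * eps ^+ 2 * dt
      + 6 * T * xb * dt * (defect_rate * dt + (i.+1 == N)%:R * Clgb).
    have [_ Eg] := drift_error (iN i); have [_ _ EH] := noise_error (iN i).
    apply: le_trans (lerD (ler_wpM2l c1 Eg) (ler_wpM2l c2 EH)) _.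
    set q := defect_rate * dt + _.
    have q0 : 0 <= q.
      by rewrite addr_ge0// mulr_ge0 ?Clgb_ge0// ltW.
    have qle : q <= defect_rate * T + Clgb.
      rewrite lerD ?ler_wpM2l// ler_piMl ?Clgb_ge0//.
      by case: (_ == _).
    have dv := delta_v i (ltnW (iN i)).
    (* In front of the error a bounded coefficient suffices; in front of the constant [xb] the exact
       [q] is kept, since its sum over all steps must stay of order one. *)
    have lex : q * x_ i <= q * xb + 2 * (defect_rate * T + Clgb) * delta i.
      apply: le_trans (ler_wpM2l q0 (lowrank_moment (ltnW (iN i)))) _.
      rewrite mulrDr lerD2l mulrA [q * 2]mulrC ler_wpM2r ?delta_ge0//.
      by rewrite ler_wpM2l.
    have -> : 3 * N%:R * dt ^+ 2 = 3 * T * dt by rewrite -NdtT; ring.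
    have le1 : 6 * T * dt * (q * x_ i) <= 6 * T * dt *
        (q * xb + 2 * (defect_rate * T + Clgb) * delta i).
      by rewrite ler_wpM2l// !mulr_ge0// ltW.
    have le2 : error_rate * dt * delta i <= error_rate * dt * v i.
      by rewrite ler_wpM2l// mulr_ge0 ?error_rate_ge0// ltW.
    apply: le_trans (_ : _ <= error_rate * dt * delta i +
      (12 * T + 24 * m%:R * c0) * eps ^+ 2 * dt + 6 * T * xb * dt * q) _.
      rewrite -subr_ge0; move: le1; rewrite -subr_ge0; congr (0 <= _).
      by rewrite /error_rate; ring.
    by rewrite lerD2r lerD2r.
  rewrite -addrA !mulr_sumr -big_split /=.
  apply: le_trans (lerD (lexx _) (ler_sum _ (fun i _ => per_step i))) _.
  rewrite !big_split /= sumr_const card_ord -!mulr_sumr big_split /=.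
  rewrite sumr_const card_ord -mulr_suml sum_last_step//.
  set s := \sum_(i < n) v i.
  have nT : n%:R * dt <= T := t_le nN.
  have le1 : (12 * T + 24 * m%:R * c0) * eps ^+ 2 * dt *+ n <= error_eps * eps ^+ 2.
    rewrite -mulr_natl /error_eps.
    have -> : n%:R * ((12 * T + 24 * m%:R * c0) * eps ^+ 2 * dt) =
        (12 * T + 24 * m%:R * c0) * eps ^+ 2 * (n%:R * dt) by ring.
    rewrite [leRHS]mulrAC ler_wpM2l// mulr_ge0//.
    by rewrite addr_ge0// !mulr_ge0.
  (* The prefactor already carries one [dt]; the regular defects sum to at most [defect_rate * T]
     and the last one adds [Clgb] once. *)
  have le2 : 6 * T * xb * dt * (defect_rate * dt *+ n + (n == N)%:R * Clgb) <=
      error_dt * dt.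
    rewrite /error_dt -/xb [leRHS]mulrAC ler_wpM2l//.
      by rewrite mulr_ge0// ?(ltW dt_gt0)// !mulr_ge0.
    rewrite lerD//; last by rewrite ler_piMl ?Clgb_ge0//; case: (_ == _).
    by rewrite -mulrnAr -mulr_natl ler_wpM2l.
  rewrite /B -/(delta 0); move: (_ *+ n) (6 * T * xb * dt * _) le1 le2 => p q.
  lra.
have A0 : 0 <= error_rate * dt by rewrite mulr_ge0 ?error_rate_ge0// ltW.
apply: le_trans (discrete_gronwall A0 B0 step (leqnn N)) _.
have -> : error_rate * dt * N%:R = error_rate * T by rewrite -NdtT; ring.
rewrite /error_const mulrAC ler_wpM2r ?expR_ge0//.
have d0 := delta_ge0 0; have e1 := error_eps_ge0; have e2 := error_dt_ge0.
have dt0 := ltW dt_gt0.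
rewrite /B; move: (delta 0) error_eps error_dt (eps ^+ 2) d0 e1 e2 eps20 => x y z u.
move=> x0 y0 z0 u0; rewrite -subr_ge0.
have -> : (3 + y + z) * (x + dt + u) - (3 * x + y * u + z * dt) =
   (y + z) * x + (3 + y) * dt + (3 + z) * u by ring.
by rewrite !addr_ge0// mulr_ge0// addr_ge0.
Qed.

End scheme.

End comparison.

Lemma sum3_le_sqr {R : realType} (x y z : R) : 0 <= x -> 0 <= y -> 0 <= z ->
  x ^+ 2 + y ^+ 2 + z ^+ 2 <= (x + y + z) ^+ 2.
Proof.
move=> x0 y0 z0; rewrite -subr_ge0.
have -> : (x + y + z) ^+ 2 - (x ^+ 2 + y ^+ 2 + z ^+ 2) =
    2 * (x * y + y * z + z * x) by ring.
by rewrite mulr_ge0// !addr_ge0// mulr_ge0.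
Qed.

Theorem theorem5p3 (R : realType) (disp : measure_display)
    (Omega : measurableType disp) (P : probability Omega R)
    (F : R -> set (set Omega)) (hF : usual_conditions P F)
    (m d k : nat) (hm : (0 < m)%N) (hk : (0 < k)%N) (hkd : (k <= d)%N)
    (W : R -> Omega -> 'cV[R]_m) (hW : brownian_motion P F W)
    (T : R) (hT : 0 < T)
    (a : R -> 'cV[R]_d -> 'cV[R]_d) (b : R -> 'cV[R]_d -> 'M[R]_(d, m))
    (ha : borel_coefficient a) (hb : borel_coefficient b)
    (CLip Clgb alpha Cna : R)
    (ha_lip : forall s x y, 0 <= s ->
       enorm (a s x - a s y) <= CLip * enorm (x - y))
    (hb_lip : forall s x y, 0 <= s ->
       frob (b s x - b s y) <= CLip * enorm (x - y))
    (h_growth : forall s x, 0 <= s ->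
       enorm (a s x) ^+ 2 + frob (b s x) ^+ 2 <= Clgb * (1 + enorm x ^+ 2))
    (halpha : 0 < alpha) (hCna : 0 < Cna)
    (h_time : forall t s x, 0 <= t <= T -> 0 <= s <= T ->
       enorm (a t x - a s x) + specnorm (b t x - b s x)
         <= Cna * (1 + enorm x) * `|t - s| `^ alpha)
    (X0true : Omega -> 'cV[R]_d)
    (hX0_meas : mx_measurable (F 0) X0true) (hX0_L2 : L2 P X0true) :
  exists C : R, 0 < C /\
  forall (U0 : 'M[R]_(k, d)) (Y0 : Omega -> 'cV[R]_k)
    (U : R -> 'M[R]_(k, d)) (Y : R -> Omega -> 'cV[R]_k)
    (N : nat) (Un : nat -> 'M[R]_(k, d)) (Yn : nat -> Omega -> 'cV[R]_k)
    (gamma eps : R),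
  U0 *m U0^T = 1%:M ->
  mx_measurable (F 0) Y0 -> L2 P Y0 -> lin_indep P Y0 ->
  DO_solution P F W a b T U0 Y0 U Y ->
  (0 < N)%N ->
  let dt := T / N%:R in
  let X t w := (U t)^T *m Y t w in
  let Xn n w := (Un n)^T *m Yn n w in
  let XEM := euler_maruyama W a b dt X0true in
  DLR_PS_scheme P W a b dt N U0 Y0 Un Yn ->
  0 < gamma ->
  (forall s, 0 <= s <= T ->
     gram P (Y s) \in unitmx /\
     specnorm (invmx (gram P (Y s))) <= 1 / gamma) ->
  (forall n, (n < N)%N ->
     gram P (Yn n) \in unitmx /\
     specnorm (invmx (gram P (Yn n))) <= 1 / gamma) ->
  0 <= eps ->
  (eps ^+ 2)%:E = eps2 P k a b T (Ktilde P T X N Xn) ->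
  (sqrte 'E_P[fun w => (\big[Num.max/0]_(n < N.+1)
                          enorm (XEM n w - Xn n w) ^+ 2)%R]
   <= C%:E * (sqrte 'E_P[fun w => (enorm (X0true w - Xn 0%N w) ^+ 2)%R]
              + (Num.sqrt dt)%:E + eps%:E))%E.
Proof.
pose c0 : R := 4 * Num.sqrt 2.
have c00 : 0 <= c0 by rewrite mulr_ge0 ?sqrtr_ge0.
have F0 := uc_sigma_algebra hF (lexx 0).
have aX0 : adapted_mx (F 0) X0true by apply/adapted_mx_measurable.
have SX0 : sqmx P X0true by exact/L2_sqmx.
pose K := error_const P m CLip Clgb T c0 X0true.
(* [K] involves only data fixed before the initial factors, [N] and [gamma]; the modulus and the 1
   make the constant positive whatever the sign of [K]. *)
exists (Num.sqrt (`|K| + 1)); split; first by rewrite sqrtr_gt0 ltr_wpDl.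
move=> U0 Y0 U Y N Un Yn gamma eps UU mY0 LY0 _ _ N0 dt X Xn XEM scheme _ _.
move=> gram_inv eps0 epsE.
have dt0 : 0 < dt by rewrite divr_gt0// ltr0n.
have NdtT : N%:R * dt = T by rewrite mulrC divfK// pnatr_eq0 -lt0n.
have nz : noise P (fun n => F (n%:R * dt)) (increment W dt) (c0 * dt).
  exact (brownian_noise hF hW dt0).
have aX0' : adapted_mx (F (0%:R * dt)) X0true by rewrite mul0r.
have aY0 : adapted_mx (F (0%:R * dt)) Y0.
  by rewrite mul0r; apply/adapted_mx_measurable.
have SY0 : sqmx P Y0 by exact/L2_sqmx.
have SXn n (nN : (n <= N)%N) : sqmx P (Xn n) :=
  (lowrank_adapted ha hb h_growth dt0 N0 NdtT c00 nz UU aY0 SY0 scheme nN).2.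
have IXn : integ P (fun w => runmax (fun n => sqnorm (Xn n w)) N).
  apply: (@integ_runmax _ _ _ P (fun n w => sqnorm (Xn n w))) => n nN.
  exact: integ_sqnorm (SXn n nN).
have moment_le n : (n <= N)%N ->
    ((mean P (fun w => sqnorm (Xn n w)))%:E <= Ktilde P T X N Xn)%E.
  move=> nN; apply: le_Ktilde => //; apply: le_mean => // [|w].
    exact: integ_sqnorm (SXn n nN).
  exact: (le_runmax (fun n => sqnorm (Xn n w))).
have [Ie Ee] := lowrank_error ha hb ha_lip hb_lip h_growth dt0 N0 NdtT c00 nz UU
  aY0 SY0 scheme epsE moment_le (fun n nN => (gram_inv n nN).1) aX0' SX0.
have E1 : (fun w =>
    (\big[Num.max/0]_(n < N.+1) enorm (XEM n w - Xn n w) ^+ 2)) =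
    (fun w => runmax (fun n => sqnorm (XEM n w - Xn n w)) N).
  by apply/funext => w; apply: eq_bigr => n _; rewrite enorm_sqr.
have E2 : (fun w => enorm (X0true w - Xn 0%N w) ^+ 2) =
    (fun w => sqnorm (X0true w - Xn 0%N w)).
  by apply/funext => w; rewrite enorm_sqr.
have I0 : integ P (fun w => sqnorm (X0true w - Xn 0%N w)).
  by apply: integ_sqnorm; apply: sqmxD => //; apply: sqmxN; exact: SXn.
rewrite E1 E2 !expectationE//= -!EFinD -EFinM lee_fin.
rewrite -/K in Ee; set v := mean P _ in Ee *; set u := mean P _ in Ee *.
have u0 : 0 <= u by apply: mean_ge0 => w; exact: sqnorm_ge0.
have K1 : 0 <= `|K| + 1 by rewrite addr_ge0.
have s0 : 0 <= Num.sqrt u + Num.sqrt dt + eps by rewrite !addr_ge0 ?sqrtr_ge0.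
(* The nonnegative right-hand sum is rewritten as the root of its square, which reduces the claim to
   an inequality between squares. *)
rewrite -[X in _ * X](ger0_norm s0) -[X in _ * X]sqrtr_sqr -sqrtrM//.
rewrite ler_wsqrtr//.
apply: le_trans Ee _.
have le_sum : u + dt + eps ^+ 2 <= (Num.sqrt u + Num.sqrt dt + eps) ^+ 2.
  have := sum3_le_sqr (sqrtr_ge0 u) (sqrtr_ge0 dt) eps0.
  by rewrite !sqr_sqrtr// ltW.
apply: le_trans (_ : _ <= (`|K| + 1) * (u + dt + eps ^+ 2)) _.
  rewrite ler_wpM2r//; first by rewrite !addr_ge0 ?sqr_ge0// ltW.
  by rewrite (le_trans (ler_norm _))// lerDl.
by rewrite ler_wpM2l.
Qed.
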